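(* Let $\mathbb{F}$ be a finite field of characteristic $p$, let $m$ be a positive integer, and let $\mathcal{M}$ be a minor-closed class of $\mathbb{F}$-represented matroids. (a) Suppose there exist $k\in\mathbb{Z}_+$ and frame templates $\Phi_1,\ldots,\Phi_s,\Psi_1,\ldots,\Psi_t$ over $\mathbb{F}$ such that (1) $\mathcal{M}$ contains each of $\mathcal{M}(\Phi_1),\ldots,\mathcal{M}(\Phi_s)$; (2) $\mathcal{M}$ contains the duals of the represented matroids in each of $\mathcal{M}(\Psi_1),\ldots,\mathcal{M}(\Psi_t)$; and (3) if $M$ is a simple $k$-connected member of $\mathcal{M}$ with at least $2k$ elements whose underlying matroid $\widetilde M$ has no $\mathrm{PG}(m-1,\mathbb{F}_p)$-minor, then $M$ belongs to some $\mathcal{M}(\Phi_i)$ or $M^*$ belongs to some $\mathcal{M}(\Psi_j)$. Then the constant $k$ and the templates $\Phi_1,\ldots,\Phi_s,\Psi_1,\ldots,\Psi_t$ can be chosen so that (1)–(3) hold and all the templates are refined. (b) Suppose there exist $k,n\in\mathbb{Z}_+$ and frame templates $\Phi_1,\ldots,\Phi_s,\Psi_1,\ldots,\Psi_t$ over $\mathbb{F}$ such that (1) and (2) above hold, and (3') if $M$ is a simple vertically $k$-connected member of $\mathcal{M}$ with an $M(K_n)$-minor but no $\mathrm{PG}(m-1,\mathbb{F}_p)$-minor, then $M$ belongs to some $\mathcal{M}(\Phi_i)$; and (4') if $M$ is a cosimple cyclically $k$-connected member of $\mathcal{M}$ with an $M^*(K_n)$-minor but no $\mathrm{PG}(m-1,\mathbb{F}_p)$-minor,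 then $M^*$ belongs to some $\mathcal{M}(\Psi_j)$. Then the constants $k,n$ and the templates can be chosen so that (1), (2), (3'), (4') hold and all the templates are refined.
   Context: $\mathbb{F}_p$ is the prime subfield of $\mathbb{F}$ and $\mathbb{F}^\times$ its multiplicative group. For disjoint $A,B$, identify $\mathbb{F}^A\times\mathbb{F}^B$ with $\mathbb{F}^{A\cup B}$; $U[X]$ is the set of coordinate projections onto $X$ of vectors in $U\subseteq\mathbb{F}^E$; $\Gamma U=\{\gamma u:\gamma\in\Gamma,u\in U\}$; additive subgroups $U,W$ are skew if $U\cap W=\{0\}$. A frame matrix has at most two nonzero entries per column; for $\Gamma\le\mathbb{F}^\times$, a $\Gamma$-frame matrix is a frame matrix in which each nonzero column contains a $1$ and any second nonzero entry equals $-\gamma$ for some $\gamma\in\Gamma$. A frame template is a tuple $\Phi=(\Gamma,C,X,Y_0,Y_1,A_1,\Delta,\Lambda)$ with $\Gamma\le\mathbb{F}^\times$; $C,X,Y_0,Y_1$ disjoint finite sets; $A_1\in\mathbb{F}^{X\times(C\cup Y_0\cup Y_1)}$; $\Lambda$ an additive subgroup of $\mathbb{F}^X$ closed under scaling by $\Gamma$; $\Delta$ an additive subgroup of $\mathbb{F}^{C\cup Y_0\cup Y_1}$ closed under scaling by $\Gamma$. A matrix $A'\in\mathbb{F}^{B\times E}$ respects $\Phi$ if $X\subseteq B$, $C,Y_0,Y_1\subseteq E$, $A'[X,C\cup Y_0\cup Y_1]=A_1$, and there is $Z\subseteq E-(C\cup Y_0\cup Y_1)$ with $A'[X,Z]=0$,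 each column of $A'[B-X,Z]$ a unit vector, $A'[B-X,E-(C\cup Y_0\cup Y_1\cup Z)]$ a $\Gamma$-frame matrix, each column of $A'[X,E-(C\cup Y_0\cup Y_1\cup Z)]$ in $\Lambda$, and each row of $A'[B-X,C\cup Y_0\cup Y_1]$ in $\Delta$. A matrix $A$ conforms to $\Phi$ if for some such $A'$ and $Z$, $A[B,E-Z]=A'[B,E-Z]$ and for each $i\in Z$ there is $j\in Y_1$ such that column $i$ of $A$ is the sum of columns $i$ and $j$ of $A'$. $\mathcal{M}(\Phi)$ is the set of $\mathbb{F}$-represented matroids isomorphic to $M(A)/C\backslash Y_1$ for some $A$ conforming to $\Phi$. $\Phi$ is reduced if there is a partition $(X_0,X_1)$ of $X$ (a reduction partition) with $\Delta=\Gamma(\mathbb{F}_p^C\times\Delta')$ for some additive subgroup $\Delta'$ of $\mathbb{F}^{Y_0\cup Y_1}$; $\mathbb{F}_p^{X_0}\subseteq\Lambda[X_0]$, $\Lambda[X_1]=\{0\}$, $A_1[X_1,C]=0$; and the rows of $A_1[X_1,C\cup Y_0\cup Y_1]$ form a basis for a subspace whose additive group is skew to $\Delta$. $\Phi$ is refined if it is reduced with reduction partition $(X_0,X_1)$ and $Y_1$ spans $M(A_1[X_1,Y_0\cup Y_1])$. A matroid is vertically $k$-connected if for every partition $(A,B)$ of $E(M)$ with $r(A)+r(B)-r(M)<k-1$, $A$ or $B$ spans $E(M)$; $M$ is cyclically $k$-connected if $M^*$ is vertically $k$-connected; $k$-connected means Tutte $k$-connected. $\widetilde M$ denotes the underlying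 (unrepresented) matroid of $M$. *)

(* Defs.v *)
From HB Require Import structures.
From mathcomp Require Import all_boot all_order all_fingroup all_algebra.
From mathcomp Require Import zify.

Set Implicit Arguments.
Unset Strict Implicit.
Unset Printing Implicit Defensive.

Import GRing.Theory.

Local Open Scope nat_scope.

(** * Matroids, presented by their rank function *)

Record matroid := Matroid {
  mground :> finType;
  mrank : {set mground} -> nat;
  mrank_card : forall S : {set mground}, mrank S <= #|S|;
  mrank_mono : forall S T : {set mground}, S \subset T -> mrank S <= mrank T;
  mrank_submod : forall S T : {set mground},
    mrank (S :|: T) + mrank (S :&: T) <= mrank S + mrank T
}.


Lemma rank_le_card (E : finType) (r : {set E} -> nat) :
  r set0 = 0 -> (forall e, r [set e] <= 1) ->
  (forall S T, r (S :|: T) + r (S :&: T) <= r S + r T) ->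
  forall S, r S <= #|S|.
Proof.
move=> r0 r1 rU S; have [n] := ubnP #|S|; elim: n S => // n IH S ltSn.
have [->|[e eS]] := set_0Vmem S; first by rewrite r0.
have := rU [set e] (S :\ e); rewrite setD1K //.
have := IH (S :\ e); rewrite (cardsD1 e S) eS in ltSn *.
by move=> /(_ ltSn); have := r1 e; lia.
Qed.

Section MatroidOperations.
Variable M : matroid.

Definition mfull_rank := mrank [set: M].

Definition mspans (S : {set M}) := mrank S = mfull_rank.

Lemma mrankU_le (S T : {set M}) : mrank (S :|: T) <= mrank S + #|T|.
Proof. by have := mrank_submod S T; have := mrank_card T; lia. Qed.

Definition dual_rank (S : {set M}) := #|S| + mrank (~: S) - mfull_rank.

Lemma dual_rank_sub (S : {set M}) : mfull_rank <= #|S| + mrank (~: S).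
Proof. by rewrite /mfull_rank -(setUCr (~: S)) setCK addnC mrankU_le. Qed.

Lemma dual_rank_card (S : {set M}) : dual_rank S <= #|S|.
Proof.
rewrite /dual_rank; have := mrank_mono (subsetT (~: S)).
by rewrite /mfull_rank; lia.
Qed.

Lemma dual_rank_mono (S T : {set M}) : S \subset T -> dual_rank S <= dual_rank T.
Proof.
move=> sST; rewrite /dual_rank.
have := mrankU_le (~: T) (T :\: S).
have -> : ~: T :|: T :\: S = ~: S.
  apply/setP => x; rewrite !inE; have := subsetP sST x.
  by case: (x \in S) => [/(_ isT) ->|_] //; case: (x \in T).
by rewrite cardsD (setIidPr sST); have := subset_leq_card sST; lia.
Qed.

Lemma dual_rank_submod (S T : {set M}) :
  dual_rank (S :|: T) + dual_rank (S :&: T) <= dual_rank S + dual_rank T.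
Proof.
rewrite /dual_rank.
have := dual_rank_sub S; have := dual_rank_sub T.
have := dual_rank_sub (S :|: T); have := dual_rank_sub (S :&: T).
have := mrank_submod (~: S) (~: T); rewrite -setCU -setCI.
by have := cardsUI S T; lia.
Qed.

Definition mdual := Matroid dual_rank_card dual_rank_mono dual_rank_submod.

(* [mminor C D] is M / C \ D; its rank function is S |-> r(S u C) - r(C). *)
Section Minor.
Variables C D : {set M}.
Let E := {e : M | e \notin C :|: D}.

Definition minor_rank (S : {set E}) := mrank (val @: S :|: C) - mrank C.

Lemma minor_rank_card S : minor_rank S <= #|S|.
Proof.
rewrite leq_subLR setUC; apply: leq_trans (mrankU_le _ _) _.
by rewrite leq_add2l card_imset //; apply: val_inj.
Qed.

Lemma minor_rank_mono (S T : {set E}) : S \subset T -> minor_rank S <= minor_rank T.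
Proof.
by move=> sST; rewrite leq_sub2r// mrank_mono// setSU// imsetS.
Qed.

Lemma minor_rank_submod S T :
  minor_rank (S :|: T) + minor_rank (S :&: T) <= minor_rank S + minor_rank T.
Proof.
pose r' (U : {set E}) := mrank (val @: U :|: C).
have rC U : mrank C <= r' U by rewrite mrank_mono ?subsetUr.
have rS : r' (S :|: T) + r' (S :&: T) <= r' S + r' T.
  rewrite /r' imsetU imsetI; last by move=> x y _ _; apply: val_inj.
  by rewrite setUIl setUUl mrank_submod.
have := rC S; have := rC T; have := rC (S :|: T); have := rC (S :&: T).
by rewrite /minor_rank -!/(r' _); lia.
Qed.

Definition mminor := Matroid minor_rank_card minor_rank_mono minor_rank_submod.
End Minor.

Definition simple :=
  (forall e : M, mrank [set e] = 1) /\
  (forall e f : M, e != f -> mrank [set e; f] = 2).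

(* (S, ~: S) is a j-separation when both sides have at least j elements and
   r(S) + r(~: S) - r(M) < j. *)
Definition tutte_connected k :=
  forall j (S : {set M}), 0 < j < k -> j <= #|S| -> j <= #|~: S| ->
    mfull_rank + j <= mrank S + mrank (~: S).

Definition vertically_connected k :=
  forall S : {set M}, mrank S + mrank (~: S) + 1 < mfull_rank + k ->
    mspans S \/ mspans (~: S).

End MatroidOperations.

Definition cosimple (M : matroid) := simple (mdual M).

Definition cyclically_connected (M : matroid) k :=
  vertically_connected (mdual M) k.

Definition matroid_iso (M N : matroid) :=
  exists2 f : M -> N, bijective f & forall S : {set M}, mrank (f @: S) = mrank S.

Definition has_minor (M N : matroid) :=
  exists C D : {set M}, [disjoint C & D] /\ matroid_iso N (mminor C D).

(** * Linear algebra over a finite index type *)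

Section Vectors.
Variable F : finFieldType.

(* The space F^E; the regular module F^o is what carries the vector-space
   structure over F. *)
Definition vec (E : finType) := {ffun E -> F^o}.

HB.instance Definition _ (E : finType) := Vector.on (vec E).
HB.instance Definition _ (E : finType) := Finite.on (vec E).

Lemma dim_vec (E : finType) : dim (vec E) = #|E|.
Proof. by rewrite /dim /= muln1. Qed.

(* Composition with f; for f = val, this is the coordinate projection. *)
Definition pull (E E' : finType) (f : E' -> E) (u : vec E) : vec E' :=
  [ffun x => u (f x)].

Fact pull_is_linear (E E' : finType) (f : E' -> E) : linear (pull f).
Proof. by move=> a u v; apply/ffunP => x; rewrite !ffunE. Qed.

HB.instance Definition _ (E E' : finType) (f : E' -> E) :=
  GRing.isLinear.Build F (vec E) (vec E') _ (pull f) (pull_is_linear f).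

Definition coord_proj (E : finType) (S : {set E}) :
    'Hom(vec E, vec {e : E | e \in S}) :=
  linfun (pull val).

Lemma coord_projE (E : finType) (S : {set E}) (u : vec E) e :
  coord_proj S u e = u (val e).
Proof. by rewrite lfunE ffunE. Qed.

Lemma mem_ker_coord_proj (E : finType) (S : {set E}) (u : vec E) :
  reflect (forall e, e \in S -> u e = 0%R) (u \in lker (coord_proj S)).
Proof.
rewrite memv_ker; apply: (iffP eqP) => [uS e eS|uS].
  by have /ffunP/(_ (Sub e eS)) := uS; rewrite coord_projE SubK ffunE.
by apply/ffunP => e; rewrite coord_projE ffunE uS ?(valP e).
Qed.

End Vectors.

Lemma mem_span_enum (F : finFieldType) (E : finType) (P : pred (vec F E)) :
  submod_closed P -> forall u, (u \in <<enum P>>%VS) = P u.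
Proof.
move=> [P0 PD] u; apply/idP/idP => [|Pu]; last first.
  by apply: memv_span; rewrite mem_enum.
move/coord_span ->; elim/big_ind: _ => // [x y Px Py|i _].
  by have := PD 1%R _ _ Px Py; rewrite scale1r.
rewrite -[X in P X]addr0; apply: PD => //.
by have := mem_nth 0%R (leq_trans (ltn_ord i) (eq_leq (cardE P)));
  rewrite mem_enum.
Qed.

Section Corank.
Variables (F : fieldType) (V : vectType F) (E : finType) (U : {vspace V}).
Variable k : {set E} -> {vspace V}.
Hypothesis k0 : k set0 = U.
Hypothesis kU : forall S T, k (S :|: T) = (k S :&: k T)%VS.
Hypothesis k1 : forall e, \dim U <= (\dim (k [set e])).+1.

Let r S := \dim U - \dim (k S).

Lemma corank_anti (S T : {set E}) : S \subset T -> (k T <= k S)%VS.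
Proof. by move/setUidPr <-; rewrite kU capvSl. Qed.

Lemma corank_sub S : (k S <= U)%VS.
Proof. by rewrite -k0 corank_anti ?sub0set. Qed.

Lemma corank_mono (S T : {set E}) : S \subset T -> r S <= r T.
Proof. by move=> sST; rewrite leq_sub2l// dimvS// corank_anti. Qed.

Lemma corank_submod S T : r (S :|: T) + r (S :&: T) <= r S + r T.
Proof.
have le S' : \dim (k S') <= \dim U by rewrite dimvS ?corank_sub.
have := dimv_sum_cap (k S) (k T); rewrite -kU.
have : \dim (k S + k T) <= \dim (k (S :&: T)).
  by rewrite dimvS// subv_add !corank_anti ?subsetIl ?subsetIr.
have := le S; have := le T; have := le (S :|: T); have := le (S :&: T).
by rewrite /r; lia.
Qed.

Lemma corank_card S : r S <= #|S|.
Proof.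
apply: rank_le_card S => [|e|]; last exact: corank_submod.
  by rewrite /r k0 subnn.
by have := k1 e; rewrite /r; lia.
Qed.

End Corank.

(** * Cycle matroids of complete graphs *)

Section CompleteGraph.
Variable n : nat.

Definition Kn_edge := {e : {set 'I_n} | #|e| == 2}.

Definition Kn_adj (S : {set Kn_edge}) : rel 'I_n :=
  [rel u v | [exists e in S, val e == [set u; v]]].

(* The rank of a set of edges in the cycle matroid is the number of vertices
   minus the number of connected components of the spanning subgraph. *)
Definition Kn_rank (S : {set Kn_edge}) := n - n_comp (Kn_adj S) 'I_n.

Let potential (S : {set Kn_edge}) : pred (vec 'F_2 'I_n) :=
  fun f => [forall e in S, forall u in val e, forall v in val e, f u == f v].

Let pot S := <<enum (potential S)>>%VS.

Let potentialP (S : {set Kn_edge}) (f : vec 'F_2 'I_n) :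
  reflect (forall e : Kn_edge, e \in S -> {in val e &, forall u v, f u = f v})
          (potential S f).
Proof.
apply: (iffP forall_inP) => fS e eS.
  by move=> u v ue ve; have /forall_inP/(_ u ue)/forall_inP/(_ v ve)/eqP := fS e eS.
by apply/forall_inP => u ue; apply/forall_inP => v ve; rewrite (fS e eS u v ue ve).
Qed.

Let mem_pot S f : (f \in pot S) = potential S f.
Proof.
apply: mem_span_enum; split; first by apply/potentialP => e _ u v; rewrite !ffunE.
move=> a f1 f2 /potentialP f1S /potentialP f2S; apply/potentialP => e eS u v ue ve.
by rewrite !ffunE (f1S e eS u v) ?(f2S e eS u v).
Qed.

Let Kn_adj_connect_sym S : connect_sym (Kn_adj S).
Proof.
by apply: sym_connect_sym => u v /=; apply: eq_existsb => e; rewrite setUC.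
Qed.

Let potential_connect S (f : vec 'F_2 'I_n) u v :
  potential S f -> connect (Kn_adj S) u v -> f u = f v.
Proof.
move=> /potentialP fS /connectP[p + ->]; elim: p u => //= w p IH u.
case/andP => /exists_inP[e eS /eqP eE] /IH <-.
by apply: (fS e eS); rewrite eE !inE eqxx ?orbT.
Qed.

Let dim_pot S : \dim (pot S) = n_comp (Kn_adj S) 'I_n.
Proof.
pose e := Kn_adj S; have symS := Kn_adj_connect_sym S.
have rootP u : roots e (fingraph.root e u) by apply: roots_root.
pose f (u : 'I_n) : {u | roots e u} := Sub (fingraph.root e u) (rootP u).
have -> : pot S = (linfun (@pull 'F_2 _ _ f) @: fullv)%VS.
  apply/vspaceP => h; rewrite mem_pot; apply/idP/memv_imgP => [hS|[g _ ->]].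
    exists (pull val h); rewrite ?memvf //; apply/ffunP => u.
    by rewrite lfunE !ffunE /=; apply: (potential_connect hS); apply: connect_root.
  apply/potentialP => d dS u v ud vd; rewrite lfunE /= !ffunE; congr (g _).
  apply: val_inj; apply/eqP; rewrite /= root_connect //.
  have [->|uv] := eqVneq u v; first exact: connect0.
  apply: connect1; apply/exists_inP; exists d => //; rewrite eq_sym eqEcard.
  by rewrite (eqP (valP d)) cards2 uv andbT; apply/subsetP => x; rewrite !inE => /orP[]/eqP->.
rewrite limg_dim_eq; last first.
  apply/eqP; rewrite capfv -subv0; apply/subvP => g; rewrite memv_ker memv0 => /eqP g0.
  apply/eqP/ffunP => u; have /ffunP/(_ (val u)) := g0; rewrite lfunE !ffunE => <-.
  by congr (g _); apply: val_inj; apply/esym/eqP; have := valP u.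
rewrite dimvf dim_vec card_sig /n_comp_mem; apply: eq_card => u.
by rewrite !inE andbT.
Qed.

Let pot0 : pot set0 = fullv.
Proof.
apply/vspaceP => f; rewrite mem_pot memvf; apply/potentialP => e.
by rewrite inE.
Qed.

Let potU S T : pot (S :|: T) = (pot S :&: pot T)%VS.
Proof.
apply/vspaceP => f; rewrite memv_cap !mem_pot.
apply/potentialP/andP => [fST|[/potentialP fS /potentialP fT] e].
  by split; apply/potentialP => e eS; apply: fST; rewrite inE eS ?orbT.
by rewrite inE => /orP[/fS|/fT].
Qed.

Let pot1 e : \dim {: vec 'F_2 'I_n} <= (\dim (pot [set e])).+1.
Proof.
have /cards2P[u [v [uv eE]]] : #|val e| == 2 := valP e.
pose d (f : vec 'F_2 'I_n) : vec 'F_2 unit := [ffun=> (f u - f v)%R].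
have d_lin : linear d.
  move=> a f g; apply/ffunP => x; rewrite !ffunE.
  by rewrite opprD addrACA scalerBr.
pose D : {linear vec 'F_2 'I_n -> vec 'F_2 unit} := HB.pack d
   (GRing.isLinear.Build 'F_2 (vec 'F_2 'I_n) (vec 'F_2 unit) _ d d_lin).
rewrite -(limg_ker_dim (linfun D) fullv) -(addn1 (\dim (pot _))) leq_add //.
  rewrite capfv dimvS//; apply/subvP => f; rewrite memv_ker mem_pot => /eqP f0.
  have /ffunP/(_ tt) := f0; rewrite lfunE /= !ffunE => /eqP; rewrite subr_eq0 => /eqP fuv.
  apply/potentialP => e'; rewrite inE => /eqP -> x y.
  by rewrite eE !inE => /orP[]/eqP-> /orP[]/eqP->.
by apply: leq_trans (dimvS (subvf _)) _; rewrite dimvf dim_vec card_unit.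
Qed.

Let Kn_rankE S : Kn_rank S = \dim {: vec 'F_2 'I_n} - \dim (pot S).
Proof. by rewrite dim_pot dimvf dim_vec card_ord. Qed.

Lemma Kn_rank_card S : Kn_rank S <= #|S|.
Proof. by rewrite Kn_rankE; apply: corank_card. Qed.

Lemma Kn_rank_mono (S T : {set Kn_edge}) : S \subset T -> Kn_rank S <= Kn_rank T.
Proof. by rewrite !Kn_rankE; apply: corank_mono. Qed.

Lemma Kn_rank_submod S T :
  Kn_rank (S :|: T) + Kn_rank (S :&: T) <= Kn_rank S + Kn_rank T.
Proof. by rewrite !Kn_rankE; apply: corank_submod. Qed.

Definition MK := Matroid Kn_rank_card Kn_rank_mono Kn_rank_submod.

End CompleteGraph.

(** * Projective geometries over prime fields *)

Section ProjectiveGeometry.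
Variables d p : nat.

Definition PG_line (v : 'rV['F_p]_d) : {set 'rV['F_p]_d} :=
  [set (a *: v)%R | a : 'F_p].

Definition PG_point :=
  {P : {set 'rV['F_p]_d} | [exists v, (v != 0%R) && (P == PG_line v)]}.

Definition PG_span (S : {set PG_point}) : {vspace 'rV['F_p]_d} :=
  <<enum (\bigcup_(P in S) val P)>>%VS.

Definition PG_rank (S : {set PG_point}) := \dim (PG_span S).

Let PG_spanS (S T : {set PG_point}) : S \subset T -> (PG_span S <= PG_span T)%VS.
Proof.
move=> /subsetP sST; apply: sub_span => v; rewrite !mem_enum.
by move=> /bigcupP[P PS vP]; apply/bigcupP; exists P => //; apply: sST.
Qed.

Let PG_spanU S T : (PG_span (S :|: T) <= PG_span S + PG_span T)%VS.
Proof.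
apply/span_subvP => v; rewrite mem_enum => /bigcupP[P + vP].
rewrite inE => /orP[] PS; [apply: (subvP (addvSl _ _))|apply: (subvP (addvSr _ _))];
  by apply: memv_span; rewrite mem_enum; apply/bigcupP; exists P.
Qed.

Lemma PG_rank_mono (S T : {set PG_point}) : S \subset T -> PG_rank S <= PG_rank T.
Proof. by move=> sST; rewrite dimvS ?PG_spanS. Qed.

Lemma PG_rank_submod S T :
  PG_rank (S :|: T) + PG_rank (S :&: T) <= PG_rank S + PG_rank T.
Proof.
rewrite /PG_rank -(dimv_sum_cap (PG_span S)) leq_add ?dimvS ?PG_spanU //.
by rewrite subv_cap !PG_spanS ?subsetIl ?subsetIr.
Qed.

Lemma PG_rank_card S : PG_rank S <= #|S|.
Proof.
apply: rank_le_card S => [|P|]; last exact: PG_rank_submod.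
  apply/eqP; rewrite dimv_eq0 -subv0; apply/span_subvP => v.
  by rewrite mem_enum big_set0 inE.
have /existsP[v /andP[_ /eqP PE]] := valP P.
rewrite /PG_rank; apply: leq_trans (_ : \dim <[v]> <= 1); last by rewrite dim_vline leq_b1.
apply/dimvS/span_subvP => w; rewrite mem_enum big_set1 PE => /imsetP[a _ ->].
by rewrite memvZ ?memv_line.
Qed.

(* PG(d - 1, F_p). *)
Definition PG := Matroid PG_rank_card PG_rank_mono PG_rank_submod.

End ProjectiveGeometry.

(** * Represented matroids *)

(* An F-represented matroid is a finite ground set E with a subspace of F^E,
   which for M(A) is the row space of A. *)
Record rep_matroid (F : finFieldType) := RepMatroid {
  rground :> finType;
  rspace : {vspace vec F rground}
}.

Section RepresentedMatroids.
Variable F : finFieldType.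
Implicit Types M N : rep_matroid F.

Definition mx_row (B E : finType) (A : B -> E -> F) (b : B) : vec F E :=
  [ffun e => A b e].

Definition mx_matroid (B E : finType) (A : B -> E -> F) : rep_matroid F :=
  @RepMatroid F E <<[seq mx_row A b | b : B]>>%VS.

Definition rep_rank M (S : {set M}) := \dim (coord_proj F S @: rspace M).

Section RepRank.
Variable M : rep_matroid F.

Let K (S : {set M}) := (rspace M :&: lker (coord_proj F S))%VS.

Let memK (S : {set M}) u :
  reflect (u \in rspace M /\ forall e, e \in S -> u e = 0%R) (u \in K S).
Proof.
rewrite memv_cap; apply: (iffP andP) => -[uM uS]; split=> //.
  exact/mem_ker_coord_proj.
exact/mem_ker_coord_proj.
Qed.

Let K0 : K set0 = rspace M.
Proof.
apply/vspaceP => u; apply/memK/idP => [[]//|uM]; split=> // e.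
by rewrite inE.
Qed.

Let KU S T : K (S :|: T) = (K S :&: K T)%VS.
Proof.
apply/vspaceP => u; rewrite memv_cap.
apply/memK/andP => [[uM uST]|[/memK[uM uS] /memK[_ uT]]].
  by split; apply/memK; split=> // e eS; apply: uST; rewrite inE eS ?orbT.
by split=> // e; rewrite inE => /orP[/uS|/uT].
Qed.

Let rep_rankE S : rep_rank S = \dim (rspace M) - \dim (K S).
Proof. by rewrite -(limg_ker_dim (coord_proj F S) (rspace M)) addKn. Qed.

Let K1 e : \dim (rspace M) <= (\dim (K [set e])).+1.
Proof.
rewrite -(limg_ker_dim (coord_proj F [set e]) (rspace M)) -addn1 leq_add2l.
by apply: leq_trans (dimvS (subvf _)) _; rewrite dimvf dim_vec card_sig cards1.
Qed.

Lemma rep_rank_card (S : {set M}) : rep_rank S <= #|S|.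
Proof. by rewrite rep_rankE; apply: corank_card. Qed.

Lemma rep_rank_mono (S T : {set M}) : S \subset T -> rep_rank S <= rep_rank T.
Proof. by rewrite !rep_rankE; apply: corank_mono. Qed.

Lemma rep_rank_submod (S T : {set M}) :
  rep_rank (S :|: T) + rep_rank (S :&: T) <= rep_rank S + rep_rank T.
Proof. by rewrite !rep_rankE; apply: corank_submod. Qed.

Definition underlying := Matroid rep_rank_card rep_rank_mono rep_rank_submod.

End RepRank.

Definition orthogonal (E : finType) (u v : vec F E) :=
  (\sum_e u e * v e == 0 :> F)%R.

Definition rdual M : rep_matroid F :=
  @RepMatroid F M
    <<enum [pred v : vec F M |
              [forall u : vec F M, (u \in rspace M) ==> orthogonal u v]]>>%VS.

Lemma mem_rdual M (v : vec F M) :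
  (v \in rspace (rdual M)) =
  [forall u : vec F M, (u \in rspace M) ==> orthogonal u v].
Proof.
apply: mem_span_enum; split.
  apply/forall_inP => u _; rewrite /orthogonal big1// => e _.
  by rewrite ffunE mulr0.
move=> a v1 v2 /forall_inP v1M /forall_inP v2M; apply/forall_inP => u uM.
rewrite /orthogonal; under eq_bigr do rewrite !ffunE mulrDr mulrCA.
by rewrite big_split -mulr_sumr (eqP (v1M u uM)) (eqP (v2M u uM)) /= mulr0 addr0.
Qed.

(* M / C \ D *)
Definition rminor M (C D : {set M}) : rep_matroid F :=
  @RepMatroid F {e : M | e \notin C :|: D}
    (linfun (pull val) @: (rspace M :&: lker (coord_proj F C)))%VS.

(* Represented matroids are considered up to projective equivalence: an
   isomorphism is a bijection of the ground sets followed by a scaling of the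
   coordinates by nonzero scalars. *)
Definition rep_iso M N :=
  exists (f : M -> N) (c : M -> F),
    [/\ bijective f, forall e, c e != 0%R &
        forall v : vec F N,
          (v \in rspace N) = ([ffun e => (c e * v (f e))%R] \in rspace M)].

Definition minor_closed (cM : rep_matroid F -> Prop) :=
  (forall M N, rep_iso M N -> cM M -> cM N) /\
  (forall M (C D : {set M}), [disjoint C & D] -> cM M -> cM (rminor C D)).

End RepresentedMatroids.

(** * Frame templates *)

Section Templates.
Variable F : finFieldType.

Definition add_subgroup (E : finType) (S : {set vec F E}) :=
  (0%R \in S) /\ {in S &, forall u v, (u - v)%R \in S}.

Definition scale_closed (G : {group {unit F}}) (E : finType)
    (S : {set vec F E}) :=
  forall g u, g \in G -> u \in S -> (val g *: u)%R \in S.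

(* The pairwise disjoint sets C, X, Y0, Y1 are separate index types, and
   C u Y0 u Y1 is their sum [tcol]. *)
Record frame_template := FrameTemplate {
  tGamma : {group {unit F}};
  tC : finType;
  tX : finType;
  tY0 : finType;
  tY1 : finType;
  tA1 : tX -> (tC + (tY0 + tY1))%type -> F;
  tDelta : {set vec F (tC + (tY0 + tY1))%type};
  tLambda : {set vec F tX};
  tDelta_subgroup : add_subgroup tDelta;
  tDelta_scale : scale_closed tGamma tDelta;
  tLambda_subgroup : add_subgroup tLambda;
  tLambda_scale : scale_closed tGamma tLambda
}.

Variable Phi : frame_template.

Definition tcol : finType := (tC Phi + (tY0 Phi + tY1 Phi))%type.

Definition col_C (c : tC Phi) : tcol := inl c.
Definition col_Y1 (y : tY1 Phi) : tcol := inr (inr y).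

Definition frame_matrix (B E : finType) (A : B -> E -> F) :=
  forall e, #|[set b | A b e != 0%R]| <= 2.

Definition Gamma_frame_matrix (G : {group {unit F}}) (B E : finType)
    (A : B -> E -> F) :=
  frame_matrix A /\
  forall e, (exists b, A b e != 0%R) ->
    exists2 b, A b e = 1%R &
      forall b', b' != b -> A b' e != 0%R ->
        exists2 g, g \in G & A b' e = (- val g)%R.

(* The rows B are X + B' and the columns E are (C u Y0 u Y1) + E', so that Z
   is a subset of E'. *)
Definition respects (B' E' : finType)
    (A : (tX Phi + B')%type -> (tcol + E')%type -> F) (Z : {set E'}) :=
  [/\ forall x t, A (inl x) (inl t) = tA1 x t,
      forall x z, z \in Z -> A (inl x) (inr z) = 0%R &
      forall z, z \in Z ->
        exists b, forall b', A (inr b') (inr z) = (b' == b)%:R%R] /\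
  [/\ Gamma_frame_matrix (tGamma Phi)
        (fun b (e : {e : E' | e \notin Z}) => A (inr b) (inr (val e))),
      forall e, e \notin Z ->
        ([ffun x => A (inl x) (inr e)] : vec F (tX Phi)) \in tLambda Phi &
      forall b,
        ([ffun t => A (inr b) (inl t)] : vec F tcol) \in tDelta Phi].

Definition conforms (B' E' : finType)
    (A : (tX Phi + B')%type -> (tcol + E')%type -> F) :=
  exists A' Z, [/\ @respects B' E' A' Z,
    forall b t, A b (inl t) = A' b (inl t),
    forall b e, e \notin Z -> A b (inr e) = A' b (inr e) &
    forall z, z \in Z -> exists y, forall b,
      A b (inr z) = (A' b (inr z) + A' b (inl (col_Y1 y)))%R].

Definition template_class (M : rep_matroid F) :=
  exists (B' E' : finType) (A : (tX Phi + B')%type -> (tcol + E')%type -> F),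
    conforms A /\
    rep_iso M (@rminor F (mx_matroid A)
                 [set inl (col_C c) | c : tC Phi]
                 [set inl (col_Y1 y) | y : tY1 Phi]).

Definition prime_subfield (x : F) := exists n : nat, x = n%:R%R.

Definition row_A1 (x : tX Phi) : vec F tcol := mx_row (@tA1 Phi) x.

(* (X0, ~: X0) is a reduction partition. *)
Definition reduction_partition (X0 : {set tX Phi}) :=
  [/\ exists2 Delta' : {set vec F (tY0 Phi + tY1 Phi)%type},
        add_subgroup Delta' &
        forall d : vec F tcol, d \in tDelta Phi <->
          exists (g : {unit F}) (u : vec F (tC Phi)) w,
            [/\ g \in tGamma Phi, forall c, prime_subfield (u c), w \in Delta' &
                d = [ffun t => (val g * match t with
                                        | inl c => u c
                                        | inr y => w y
                                        end)%R]],
      forall u : vec F {x | x \in X0}, (forall x, prime_subfield (u x)) ->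
        exists2 l, l \in tLambda Phi & coord_proj F X0 l = u,
      forall l, l \in tLambda Phi -> coord_proj F (~: X0) l = 0%R,
      forall x c, x \notin X0 -> tA1 x (col_C c) = 0%R &
      free [seq row_A1 x | x in ~: X0] /\
      forall d, d \in <<[seq row_A1 x | x in ~: X0]>>%VS ->
        d \in tDelta Phi -> d = 0%R].

Definition refined :=
  exists2 X0 : {set tX Phi}, reduction_partition X0 &
    @mspans (underlying (mx_matroid
              (fun (x : {x | x \in ~: X0}) y => tA1 (val x) (inr y))))
      [set inr y | y : tY1 Phi].

End Templates.

(** * Describing the highly connected members of a class by templates *)

Section Description.
Variables (F : finFieldType) (cM : rep_matroid F -> Prop).
Variables (s t : nat).
Variables (Phi : 'I_s -> frame_template F) (Psi : 'I_t -> frame_template F).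

Definition contains_classes :=
  forall i M, template_class (Phi i) M -> cM M.

Definition contains_dual_classes :=
  forall j M, template_class (Psi j) M -> cM (rdual M).

Definition describes_connected (m p k : nat) :=
  forall M, cM M -> simple (underlying M) -> tutte_connected (underlying M) k ->
    2 * k <= #|M| -> ~ has_minor (underlying M) (PG m p) ->
    (exists i, template_class (Phi i) M) \/
    (exists j, template_class (Psi j) (rdual M)).

Definition describes_vertically_connected (m p k n : nat) :=
  forall M, cM M -> simple (underlying M) ->
    vertically_connected (underlying M) k ->
    has_minor (underlying M) (MK n) -> ~ has_minor (underlying M) (PG m p) ->
    exists i, template_class (Phi i) M.

Definition describes_cyclically_connected (m p k n : nat) :=
  forall M, cM M -> cosimple (underlying M) ->
    cyclically_connected (underlying M) k ->
    has_minor (underlying M) (mdual (MK n)) ->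
    ~ has_minor (underlying M) (PG m p) ->
    exists j, template_class (Psi j) (rdual M).

Definition all_refined :=
  (forall i, refined (Phi i)) /\ (forall j, refined (Psi j)).

End Description.

(* Main.v *)
Require Import Defs.
From HB Require Import structures.
From mathcomp Require Import all_boot all_order all_fingroup all_algebra.
From mathcomp Require Import zify.
From Stdlib Require Import Classical.

(** Three moves bring a template to refined form, up to a finite union.

    Contracting [C].  Pick one row outside [X] for each vector of [Delta] that
    occurs as a row, and use these finitely many rows to clear all others on
    [C].  A frame column meeting one picked row becomes a unit vector plus one
    of finitely many fixed columns, which are added to [Y1]; a column supported
    on the picked rows is one of finitely many columns, and it occurs at most
    once because the matroid is simple, so it is added to [Y0].  The result is
    one of finitely many templates with [C] empty, each of whose classes is
    contained in the original class.

    Reducing.  Coordinates on the span of [Lambda] and of the columns of [A_1],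
    with respect to a basis that starts with elements of [Lambda] spanning it,
    give the partition of [X].  A row of [Delta] matters only modulo the row
    space of [A_1] on [X_1], so [Delta] is replaced by an invariant complement
    of its intersection with that space.

    Refining.  If [Y1] does not span, some combination of the rows in [X_1] is
    supported on [Y0], so every member of the class has a cocircuit of size at
    most [#|Y0|].  Large connectivity together with large size, or large rank,
    rules this out, and such templates are discarded. *)

Set Implicit Arguments.
Unset Strict Implicit.
Unset Printing Implicit Defensive.

Import GRing.Theory.

Lemma mem_congr (T : Type) (S : {pred T}) x y : x = y -> x \in S -> y \in S.
Proof. by move->. Qed.

(** * Presentations of the members of a template class without a matrix *)

Section Presentations.
Local Open Scope ring_scope.
Variable F : finFieldType.

Lemma mem_mx_matroid (B E : finType) (A : B -> E -> F) (v : vec F E) :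
  v \in rspace (mx_matroid A) <->
  exists u : B -> F, forall e, v e = \sum_b u b * A b e.
Proof.
split=> [|[u uE]].
  move/(coord_span (X := image_tuple (mx_row A) predT)) => vE.
  exists (fun b => coord (image_tuple (mx_row A) predT) (enum_rank b) v) => e.
  rewrite {1}vE sum_ffunE (reindex (@enum_rank B)) /=; last first.
    exact: (onW_bij _ (enum_rank_bij B)).
  by apply: eq_bigr => b _; rewrite ffunE nth_image enum_rankK ffunE.
have -> : v = \sum_b u b *: mx_row A b.
  by apply/ffunP => e; rewrite sum_ffunE uE; apply: eq_bigr => b _; rewrite !ffunE.
apply: rpred_sum => b _; apply: rpredZ; apply: memv_span.
by apply/imageP; exists b.
Qed.

Lemma mem_rminor (M : rep_matroid F) (C D : {set M}) (v : vec F (rminor C D)) :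
  v \in rspace (rminor C D) <->
  exists z : vec F M, [/\ z \in rspace M, forall e, e \in C -> z e = 0 &
                          forall e, v e = z (val e)].
Proof.
split=> [/memv_imgP[z]|[z [zM zC zE]]].
  rewrite memv_cap => /andP[zM /mem_ker_coord_proj zC] vE.
  by exists z; split=> // e; rewrite vE lfunE ffunE.
apply/memv_imgP; exists z; first by rewrite memv_cap zM; apply/mem_ker_coord_proj.
by apply/ffunP => e; rewrite lfunE ffunE zE.
Qed.

Lemma rep_iso_mem (M N : rep_matroid F) :
  rep_iso M N <->
  exists (f : M -> N) (c : M -> F), [/\ bijective f, forall e, c e != 0 &
    forall v, v \in rspace M <->
      exists2 z, z \in rspace N & forall e, v e = c e * z (f e)].
Proof.
split=> -[f [c [fB c0 E]]]; exists f, c; split=> //.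
  have [g fK gK] := fB; move=> v; split=> [vM|[z zN zE]]; last first.
    rewrite E in zN; apply: mem_congr zN; apply/ffunP => e.
    by rewrite ffunE zE.
  exists [ffun n => (c (g n))^-1 * v (g n)].
    rewrite E; apply: mem_congr vM; apply/ffunP => e.
    by rewrite !ffunE fK mulVKf.
  by move=> e; rewrite !ffunE fK mulVKf.
move=> v; apply/idP/idP => [vN|].
  by apply/E; exists v => // e; rewrite ffunE.
move/E => [z zN zE]; suff -> : v = z by [].
have [g fK gK] := fB.
apply/ffunP => n; have := zE (g n); rewrite ffunE gK.
exact: (mulfI (c0 _)).
Qed.

Variable Phi : frame_template F.

(** A single column of a [Gamma]-frame matrix, so that columns can be moved one at a time between
    row sets. *)
Definition frame_column (G : {group {unit F}}) (B : finType) (g : B -> F) :=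
  (#|[set b | g b != 0%R]| <= 2)%N /\
  ((exists b, g b != 0) ->
    exists2 b, g b = 1 &
      forall b', b' != b -> g b' != 0 -> exists2 h, h \in G & g b' = - val h).

(** Extension by zero along an injection of row sets keeps the nonzero entries. The two directions
    serve adding and removing rows. *)
Lemma frame_column_inj (G : {group {unit F}}) (B B' : finType) (h : B -> B')
    (g : B -> F) (g' : B' -> F) : injective h -> (forall b, g' (h b) = g b) ->
  (forall b', g' b' != 0 -> exists b, b' = h b) ->
  frame_column G g <-> frame_column G g'.
Proof.
move=> hI gh hS.
have cE : #|[set b | g b != 0]| = #|[set b | g' b != 0]|.
  rewrite -(card_imset _ hI); apply: eq_card => b'; rewrite inE.
  apply/imsetP/idP => [[b + ->]|b0]; first by rewrite inE gh.
  by have [b bE] := hS _ b0; exists b; rewrite // inE -gh -bE.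
rewrite /frame_column -cE; split=> -[cg gP]; split=> //.
  move=> [b' b0]; have [b1 bE] := hS _ b0.
  have [|b b1E bP] := gP; first by exists b1; rewrite -gh -bE.
  exists (h b); rewrite ?gh // => b2 nb b20; have [b3 b2E] := hS _ b20.
  by rewrite b2E gh; apply: bP; rewrite -?gh -?b2E // -(inj_eq hI) -b2E.
move=> [b b0]; have [|b' b'E bP] := gP; first by exists (h b); rewrite gh.
have [|b1 bE] := hS b'; first by rewrite b'E oner_neq0.
exists b1; rewrite -?gh -?bE // => b2 nb; rewrite -gh; apply: bP.
by rewrite bE (inj_eq hI).
Qed.

Lemma frame_column_support (G : {group {unit F}}) (B : finType) (g : B -> F) a b :
  frame_column G g -> g a != 0 -> g b != 0 -> a != b ->
  forall d, d != a -> d != b -> g d = 0.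
Proof.
move=> [cg _] a0 b0 ab d da db; apply/eqP; apply: contraTT cg => d0.
rewrite -ltnNge; apply: (@leq_trans #|d |: [set a; b]|).
  by rewrite cardsU1 cards2 ab !inE negb_or da db.
by apply: subset_leq_card; apply/subsetP => e; rewrite !inE => /or3P[]/eqP->.
Qed.

(* A column outside C, Y0 and Y1 is recorded either by its part in Lambda and
   its frame part, or, for a column in Z, by the row of its unit vector and the
   element of Y1 that is added to it. *)
Definition loose (B : finType) : finType :=
  ((vec F (tX Phi) * vec F B) + (B * tY1 Phi))%type.

Definition valid_loose (B : finType) (l : loose B) :=
  match l with
  | inl (lam, g) => lam \in tLambda Phi /\ frame_column (tGamma Phi) g
  | inr _ => True
  end.

Section Values.
Variables (B : finType) (delta : B -> vec F (tcol Phi)).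
Variables (w : tX Phi -> F) (u : B -> F).

(** Coordinates of the row combination with coefficients [w] on [X] and [u] on [B]: here in a column
    of [C], [Y0] or [Y1], then in the loose columns, then in all columns that survive in the
    minor. *)
Definition col_val (t : tcol Phi) :=
  \sum_x w x * tA1 x t + \sum_b u b * delta b t.

Definition loose_val (l : loose B) :=
  match l with
  | inl (lam, g) => \sum_x w x * lam x + \sum_b u b * g b
  | inr (b, y) => u b + col_val (col_Y1 y)
  end.

Definition elt_val (e : tY0 Phi + loose B) :=
  match e with
  | inl y => col_val (inr (inl y))
  | inr l => loose_val l
  end.

End Values.

Lemma eq_col_val (B : finType) (delta delta' : B -> vec F (tcol Phi)) w w' u u' :
  delta =1 delta' -> w =1 w' -> u =1 u' ->
  col_val delta w u =1 col_val delta' w' u'.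
Proof.
move=> dd ww uu t; congr (_ + _); apply: eq_bigr => i _.
  by rewrite ww.
by rewrite uu dd.
Qed.

Lemma eq_elt_val (B : finType) (delta delta' : B -> vec F (tcol Phi)) w w' u u' :
  delta =1 delta' -> w =1 w' -> u =1 u' ->
  elt_val delta w u =1 elt_val delta' w' u'.
Proof.
move=> dd ww uu [y|[[l g]|[b y]]] /=; first exact: eq_col_val.
  by congr (_ + _); apply: eq_bigr => i _; rewrite ?ww ?uu.
by rewrite uu (eq_col_val dd ww uu).
Qed.

(** The row space of $M(A)/C\backslash Y_1$ without its matrix: contracting [C] is the vanishing
    condition on row combinations, deleting [Y1] is the absence of such labels, and [c] is the
    projective scaling. Each label in [Y0] is used exactly once, whereas loose labels may repeat. *)
Definition presented_by (M : rep_matroid F) (B : finType)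
    (delta : B -> vec F (tcol Phi)) (k : M -> (tY0 Phi + loose B)%type)
    (c : M -> F) :=
  [/\ forall b, delta b \in tDelta Phi,
      forall y, exists! e, k e = inl y,
      forall e l, k e = inr l -> valid_loose l,
      forall e, c e != 0 &
      forall v : vec F M, v \in rspace M <->
        exists w u, (forall a, col_val delta w u (col_C a) = 0) /\
                    forall e, v e = c e * elt_val delta w u (k e)].

Definition presented (M : rep_matroid F) :=
  exists (B : finType) delta k c, @presented_by M B delta k c.

Lemma template_class_presented M : template_class Phi M -> presented M.
Proof.
move=> [B [E [A [[A' [Z [resp eqC eqE eqZ]]] /rep_iso_mem[f [c [fB c0 fE]]]]]]].
have [[r1 r2 r3] [[r4a r4b] r5 r6]] := resp.
pose delta b : vec F (tcol Phi) := [ffun t => A' (inr b) (inl t)].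
have colE w u t : \sum_b (match b with inl x => w x | inr b => u b end) * A b (inl t)
    = col_val delta w u t.
  rewrite big_sumType; congr (_ + _); apply: eq_bigr => x _; rewrite eqC ?r1 //.
  by rewrite ffunE.
have kP e : exists k : tY0 Phi + loose B,
   [/\ forall y, k = inl y <-> val (f e) = inl (inr (inl y)),
       forall l, k = inr l -> valid_loose l &
       forall w u, \sum_b (match b with inl x => w x | inr b => u b end) * A b (val (f e))
        = elt_val delta w u k].
  have := valP (f e); rewrite inE negb_or => /andP[].
  case: (val (f e)) => [[a|[y|y]]|e'].
  - by move=> /imsetP[]; exists a.
  - move=> _ _; exists (inl y); split=> // y'.
    by split=> [[->]|[->]].
  - by move=> _ /imsetP[]; exists y.
  - move=> _ _; have [eZ|eZ] := boolP (e' \in Z).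
      have [b bE] := r3 _ eZ; have [y yE] := eqZ _ eZ.
      exists (inr (inr (b, y))); split=> // [l [<-] //|w u] /=.
      rewrite -colE; under eq_bigr do rewrite yE mulrDr.
      rewrite big_split /=; congr (_ + _); last first.
        by apply: eq_bigr => i _; rewrite eqC.
      rewrite big_sumType big1 ?add0r => [|x _]; last by rewrite r2 ?mulr0.
      rewrite (bigD1 b) //= bE eqxx mulr1 big1 ?addr0 ?add0r // => b' nb.
      by rewrite bE (negPf nb) mulr0.
    exists (inr (inl ([ffun x => A' (inl x) (inr e')], [ffun b => A' (inr b) (inr e')]))).
    split=> // [l [<-]|w u] /=.
      split; first exact: r5.
      split.
        apply: leq_trans (r4a (Sub e' eZ)); apply: subset_leq_card.
        by apply/subsetP => b; rewrite !inE ffunE.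
      move=> [b]; rewrite ffunE => b0.
      have /= [|b1 b1E b1P] := r4b (Sub e' eZ); first by exists b.
      by exists b1; rewrite ?ffunE // => b' /b1P; rewrite ffunE.
    rewrite big_sumType; congr (_ + _); apply: eq_bigr => i _; by rewrite ffunE eqE.
have [k kE] := fin_all_exists kP.
exists B, delta, k, c; split=> // [y|e l|v].
- have yP : (inl (inr (inl y)) : (tcol Phi + E)%type) \notin
     [set inl (col_C c) | c : tC Phi] :|: [set inl (col_Y1 y) | y : tY1 Phi].
    by rewrite inE negb_or; apply/andP; split; apply/imsetP => -[].
  have [g fK gK] := fB.
  exists (g (Sub (inl (inr (inl y))) yP)); split.
    by have [k1 _ _] := kE (g (Sub (inl (inr (inl y))) yP)); apply/k1; rewrite gK.
  move=> e /(proj1 (let: And3 k1 _ _ := kE e in k1 y)) fe.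
  by rewrite -[RHS]fK; congr g; apply: val_inj; rewrite fe.
- by have [_ + _] := kE e; apply.
split=> [/fE[z /mem_rminor[z' [/mem_mx_matroid[u uE] z'C zE] vE]]|[w [u [wuC vE]]]].
  have uuE : forall b, u b = match b with inl x => u (inl x) | inr b => u (inr b) end.
    by case.
  exists (u \o inl), (u \o inr); split=> [a|e].
    rewrite -colE -[RHS](z'C (inl (col_C a))); last by apply: imset_f.
    by rewrite uE; apply: eq_bigr => b _; rewrite [in RHS]uuE.
  have [_ _ <-] := kE e; rewrite vE zE uE; congr (_ * _).
  by apply: eq_bigr => b _; rewrite [in LHS]uuE.
pose uu b := match b with inl x => w x | inr b => u b end.
apply/fE; exists [ffun n => \sum_b uu b * A b (val n)].
  apply/mem_rminor; exists [ffun n => \sum_b uu b * A b n]; split.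
  - by apply/mem_mx_matroid; exists uu => e; rewrite ffunE.
  - by move=> e /imsetP[a _ ->]; rewrite ffunE colE.
  - by move=> e; rewrite !ffunE.
by move=> e; rewrite ffunE vE; have [_ _ <-] := kE e.
Qed.

(** The matrix is rebuilt from the labels: elements with a loose label index the columns outside
    $C\cup Y_0\cup Y_1$, and those labelled by a row and a member of [Y1] form [Z]. *)
Lemma presented_template_class M : presented M -> template_class Phi M.
Proof.
move=> [B [delta [k [c [dP kY kL c0 vE]]]]].
pose isl e := if k e is inr _ then true else false.
pose E : finType := {e : M | isl e}.
(* The column of [A'], before a member of [Y1] is added to it. The final default is never reached,
   since members of [E] carry loose labels. *)
pose base (e : E) := if k (val e) is inr (inl (lam, g)) then
   ((lam, [ffun b => g b]) : vec F (tX Phi) * vec F B) else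
   if k (val e) is inr (inr (b, y)) then (0, [ffun b' => (b' == b)%:R]) else (0, 0).
pose Z := [set e : E | if k (val e) is inr (inr _) then true else false].
pose A' (r : tX Phi + B) (e : tcol Phi + E) : F :=
  match r, e with
  | inl x, inl t => tA1 x t
  | inr b, inl t => delta b t
  | inl x, inr e => (base e).1 x
  | inr b, inr e => (base e).2 b
  end.
pose A (r : tX Phi + B) (e : tcol Phi + E) : F :=
  match e with
  | inl t => A' r (inl t)
  | inr e' => A' r e + if k (val e') is inr (inr (_, y)) then A' r (inl (col_Y1 y)) else 0
  end.
exists B, E, A; split.
  exists A', Z; split=> //; last 1 first.
  - move=> z; rewrite inE; case Ek: (k (val z)) => [//|[[? ?]//|[b y]]] _.
    by exists y => r; rewrite /A Ek.
  - split; first split=> //.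
    + move=> x z; rewrite inE /A' /base; case: (k (val z)) => [//|[[? ?]//|[b y]]] _.
      by rewrite ffunE.
    + move=> z; rewrite inE /A' /base; case: (k (val z)) => [//|[[? ?]//|[b y]]] _.
      by exists b => b'; rewrite ffunE.
    have fr (e : E) : e \notin Z -> exists lam g, [/\ lam \in tLambda Phi, frame_column (tGamma Phi) g &
        base e = (lam, [ffun b => g b])].
      rewrite inE /base; have := valP e; rewrite /isl.
      case Ek: (k (val e)) => [//|[[lam g]|[b y]]//] _ _.
      by exists lam, g; have [] := kL _ _ Ek.
    split=> //.
    + split.
        move=> e; have [lam [g [_ [gP _] gE]]] := fr _ (valP e).
        apply: leq_trans gP; apply: subset_leq_card; apply/subsetP => b.
        by rewrite !inE /= gE ffunE.
      move=> e; have [lam [g [_ [_ gP] gE]]] := fr _ (valP e).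
      move=> [b]; rewrite /= gE ffunE => b0; have [|b1 b1E b1P] := gP; first by exists b.
      by exists b1; rewrite ?ffunE // => b' /b1P; rewrite ffunE.
    + move=> e /fr[lam [g [lamP _ gE]]]; rewrite /= gE /=.
      by apply: mem_congr lamP; apply/ffunP => x; rewrite ffunE.
    + move=> b /=; apply: mem_congr (dP b).
      by apply/ffunP => x; rewrite ffunE.
  - move=> b e; rewrite inE /A; case: (k (val e)) => [y|[[? ?]|[? ?]]]; by rewrite ?addr0.
apply/rep_iso_mem.
pose U : {set (tcol Phi + E)} := [set inl (col_C c) | c : tC Phi] :|: [set inl (col_Y1 y) | y : tY1 Phi].
have y0P y : (inl (inr (inl y)) : (tcol Phi + E)%type) \notin U.
  by rewrite inE negb_or; apply/andP; split; apply/imsetP => -[].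
have eP e : (inr e : (tcol Phi + E)%type) \notin U.
  by rewrite inE negb_or; apply/andP; split; apply/imsetP => -[].
have fP (e : M) : exists n : {e | e \notin U},
   (forall y, k e = inl y -> val n = inl (inr (inl y))) /\
   (forall l, k e = inr l -> exists2 e', val n = inr e' & val e' = e).
  case Ek: (k e) => [y|l].
    by exists (exist _ (inl (inr (inl y))) (y0P y)); split=> // _ [<-].
  have ee : isl e by rewrite /isl Ek.
  exists (exist _ (inr (Sub e ee)) (eP (Sub e ee))); split=> // l' _.
  by exists (Sub e ee).
have [f fE] := fin_all_exists fP.
have gP (n : {e | e \notin U}) : exists e : M, f e = n.
  have := valP n; case En : (val n) => [[a|[y|y]]|e'].
  - by rewrite inE imset_f.
  - have [e [ke _]] := kY y; move=> _; exists e; apply: val_inj.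
    by rewrite En; have [+ _] := fE e; apply.
  - by rewrite !inE (imset_f (fun y => inl (col_Y1 y))) ?orbT.
  - move=> _; exists (val e'); apply: val_inj; rewrite En.
    have := valP e'; rewrite /isl; case Ek: (k (val e')) => [//|l] _.
    by have [_ /(_ l Ek)[e2 -> /val_inj ->]] := fE (val e').
have fI : injective f.
  move=> e e2 fee; case Ek: (k e) => [y|l].
    case Ek2: (k e2) => [y2|l2].
      have [/(_ _ Ek) v1 _] := fE e; have [/(_ _ Ek2) v2 _] := fE e2.
      move: v2; rewrite -fee v1 => -[yy]; rewrite -yy in Ek2.
      by have [e0 [_ e0P]] := kY y; rewrite -(e0P _ Ek) -(e0P _ Ek2).
    have [/(_ _ Ek) v1 _] := fE e; have [_ /(_ _ Ek2)[e' v2 _]] := fE e2.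
    by move: v1; rewrite fee v2.
  have [_ /(_ _ Ek)[e' v1 v1E]] := fE e.
  case Ek2: (k e2) => [y2|l2].
    by have [/(_ _ Ek2) v2 _] := fE e2; move: v2; rewrite -fee v1.
  have [_ /(_ _ Ek2)[e2' v2 v2E]] := fE e2.
  by rewrite -v1E -v2E; move: v2; rewrite -fee v1 => -[->].
have [g gK] := fin_all_exists gP.
have colE w u t : \sum_b (match b with inl x => w x | inr b => u b end) * A b (inl t)
    = col_val delta w u t by rewrite big_sumType.
have valE w u e : \sum_b (match b with inl x => w x | inr b => u b end) * A b (val (f e))
    = elt_val delta w u (k e).
  case Ek: (k e) => [y|l].
    by have [/(_ _ Ek) -> _] := fE e; rewrite colE.
  have [_ /(_ _ Ek)[e' -> e'E]] := fE e.
  under eq_bigr do rewrite /A mulrDr.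
  rewrite big_split /= e'E Ek /base; case: l Ek => [[lam h]|[b y]] Ek.
    rewrite [X in _ + X]big1 ?addr0 => [|? _]; last by rewrite mulr0.
    rewrite big_sumType /A' /base /= e'E Ek /=; congr (_ + _).
    by apply: eq_bigr => i _; rewrite ffunE.
  congr (_ + _); last by rewrite -colE.
  rewrite big_sumType /A' /base /= e'E Ek /= big1 ?add0r => [|x _]; last by rewrite ffunE mulr0.
  rewrite (bigD1 b) //= ffunE eqxx mulr1 big1 ?addr0 ?add0r // => b' nb.
  by rewrite ffunE (negPf nb) mulr0.
exists f, c; split=> //.
  by exists g => // e; apply: fI; rewrite gK.
move=> v; split=> [/vE[w [u [wuC veE]]]|[z /mem_rminor[z' [/mem_mx_matroid[u uE] z'C zE] veE]]].
  pose uu b := match b with inl x => w x | inr b => u b end.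
  exists [ffun n => \sum_b uu b * A b (val n)].
    apply/mem_rminor; exists [ffun n => \sum_b uu b * A b n]; split.
    - by apply/mem_mx_matroid; exists uu => e; rewrite ffunE.
    - by move=> e /imsetP[a _ ->]; rewrite ffunE colE.
    - by move=> e; rewrite !ffunE.
  by move=> e; rewrite ffunE veE valE.
have uuE : forall b, u b = match b with inl x => u (inl x) | inr b => u (inr b) end.
  by case.
apply/vE; exists (u \o inl), (u \o inr); split=> [a|e].
  rewrite -colE -[RHS](z'C (inl (col_C a))); last by apply: imset_f.
  by rewrite uE; apply: eq_bigr => b _; rewrite [in RHS]uuE.
rewrite -valE veE zE uE; congr (_ * _).
by apply: eq_bigr => b _; rewrite [in LHS]uuE.
Qed.

End Presentations.

(** * Changes of template that preserve presentations *)

Section TemplateMoves.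
Local Open Scope ring_scope.
Variable F : finFieldType.

(** Two row spaces agree once each row combination on one side is matched on the other. Every change
    of template below is verified in this form. *)
Lemma presented_by_transfer (T T' : frame_template F) (M : rep_matroid F)
    (B B' : finType) (delta : B -> vec F (tcol T))
    (delta' : B' -> vec F (tcol T'))
    (k : M -> (tY0 T + loose T B)%type) (k' : M -> (tY0 T' + loose T' B')%type)
    (c c' : M -> F) :
  presented_by delta k c ->
  (forall b, delta' b \in tDelta T') -> (forall y, exists! e, k' e = inl y) ->
  (forall e l, k' e = inr l -> valid_loose l) -> (forall e, c' e != 0) ->
  (forall w u, (forall a, col_val delta w u (col_C a) = 0) ->
     exists w' u', (forall a, col_val delta' w' u' (col_C a) = 0) /\
       forall e, c e * elt_val delta w u (k e)
                 = c' e * elt_val delta' w' u' (k' e)) ->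
  (forall w' u', (forall a, col_val delta' w' u' (col_C a) = 0) ->
     exists w u, (forall a, col_val delta w u (col_C a) = 0) /\
       forall e, c' e * elt_val delta' w' u' (k' e)
                 = c e * elt_val delta w u (k e)) ->
  presented_by delta' k' c'.
Proof.
move=> [_ _ _ _ vE] dP kY kL c0 fwd bwd; split=> // v.
split=> [/vE[w [u [/fwd[w' [u' [wuC E]]] veE]]]|[w' [u' [/bwd[w [u [wuC E]]] veE]]]].
  by exists w', u'; split=> // e; rewrite veE.
by apply/vE; exists w, u; split=> // e; rewrite veE.
Qed.

Section RowChange.
Variables (G : {group {unit F}}) (C X X' Y0 Y1 : finType).
Variables (A : X -> (C + (Y0 + Y1))%type -> F).
Variables (A' : X' -> (C + (Y0 + Y1))%type -> F).
Variables (D : {set vec F (C + (Y0 + Y1))%type}).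
Variables (L : {set vec F X}) (L' : {set vec F X'}).
Hypotheses (D1 : add_subgroup D) (D2 : scale_closed G D).
Hypotheses (L1 : add_subgroup L) (L2 : scale_closed G L).
Hypotheses (L1' : add_subgroup L') (L2' : scale_closed G L').
Variables (P : X' -> X -> F) (Q : X -> X' -> F).
Hypothesis PA : forall x' t, A' x' t = \sum_x P x' x * A x t.
Hypothesis QA : forall x t, A x t = \sum_x' Q x x' * A' x' t.
Let Pmul (l : vec F X) : vec F X' := [ffun x' => \sum_x P x' x * l x].
Hypothesis PL : forall l, l \in L -> Pmul l \in L'.
Hypothesis QPL : forall l, l \in L ->
  forall x, l x = \sum_x' Q x x' * (\sum_y P x' y * l y).

(** [Q] has to undo [P] only on the columns of [A] and on [L], so [X] and [X'] may differ in size.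
    Row coefficients move contragrediently: by [Q] from old to new, by [P] back. *)
Lemma presented_row_change (M : rep_matroid F) :
  presented (FrameTemplate A D1 D2 L1 L2) M ->
  presented (FrameTemplate A' D1 D2 L1' L2') M.
Proof.
set T := FrameTemplate _ _ _ _ _; set T' := FrameTemplate _ _ _ _ _.
move=> [B [delta [k [c Hp]]]]; have [dP kY kL c0 _] := Hp.
pose k' e : (tY0 T' + loose T' B)%type := match k e with
  | inl y => inl y
  | inr (inl (l, g)) => inr (inl (Pmul l, g))
  | inr (inr by_) => inr (inr by_)
  end.
have kk e : (forall y, k' e = inl y <-> k e = inl y).
  by move=> y; rewrite /k'; case: (k e) => [y'|[[l g]|[b y']]]; split=> // -[->].
exists B, delta, k', c; apply: (presented_by_transfer Hp) => //.
- move=> y; have [e [ke ue]] := kY y; exists e; split; first exact/kk.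
  by move=> e' /kk /ue.
- move=> e l; rewrite /k'; case Ek: (k e) => [//|[[l' g]|[b y]]] [<-] //=.
  by have [lP gP] := kL _ _ Ek; split=> //; apply: PL.
- move=> w u wuC; pose w' (x' : X') := \sum_(x : X) w x * Q x x'.
  have colE (t : tcol T) : @col_val F T B delta w u t = @col_val F T' B delta w' u t.
    rewrite /col_val; congr (_ + _); rewrite /w' /=.
    under [RHS]eq_bigr do rewrite mulr_suml.
    rewrite exchange_big /=; apply: eq_bigr => x _; rewrite QA mulr_sumr.
    by apply: eq_bigr => x' _; rewrite mulrA.
  exists w', u; split=> [a|e]; first by have := wuC a; rewrite colE.
  congr (_ * _); rewrite /k'; case Ek: (k e) => [y|[[l g]|[b y]]] /=.
  + exact: colE.
  + congr (_ + _); have [/QPL lE _] := kL _ _ Ek.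
    under eq_bigr do rewrite lE mulr_sumr.
    rewrite exchange_big; apply: eq_bigr => x' _; rewrite ffunE /w' mulr_suml.
    by apply: eq_bigr => x _; rewrite mulrA.
  + by congr (_ + _); apply: colE.
- move=> w' u wuC; pose w (x : X) := \sum_(x' : X') w' x' * P x' x.
  have colE (t : tcol T) : @col_val F T' B delta w' u t = @col_val F T B delta w u t.
    rewrite /col_val; congr (_ + _); rewrite /w /=.
    under [RHS]eq_bigr do rewrite mulr_suml.
    rewrite exchange_big /=; apply: eq_bigr => x _; rewrite PA mulr_sumr.
    by apply: eq_bigr => x' _; rewrite mulrA.
  exists w, u; split=> [a|e]; first by have := wuC a; rewrite colE.
  congr (_ * _); rewrite /k'; case Ek: (k e) => [y|[[l g]|[b y]]] /=.
  + exact: colE.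
  + congr (_ + _); rewrite /w.
    under [RHS]eq_bigr do rewrite mulr_suml.
    rewrite exchange_big; apply: eq_bigr => x' _; rewrite ffunE mulr_sumr.
    by apply: eq_bigr => x _; rewrite mulrA.
  + by congr (_ + _); apply: colE.
Qed.

End RowChange.

Section DeltaChange.
Variables (G : {group {unit F}}) (C X Y0 Y1 : finType).
Variables (A : X -> (C + (Y0 + Y1))%type -> F).
Variables (D D' : {set vec F (C + (Y0 + Y1))%type}) (L : {set vec F X}).
Hypotheses (D1 : add_subgroup D) (D2 : scale_closed G D).
Hypotheses (D1' : add_subgroup D') (D2' : scale_closed G D').
Hypotheses (L1 : add_subgroup L) (L2 : scale_closed G L).

(* A multiple of a row of A_1 that vanishes against Lambda can be moved from a
   row in Delta to the X-part of a row combination. *)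
Lemma presented_delta_change (M : rep_matroid F) :
  (forall d, d \in D -> exists2 d', d' \in D' & exists o : X -> F,
     (forall t, d t = d' t + \sum_x o x * A x t) /\
     (forall l, l \in L -> \sum_x o x * l x = 0)) ->
  presented (FrameTemplate A D1 D2 L1 L2) M ->
  presented (FrameTemplate A D1' D2' L1 L2) M.
Proof.
set T := FrameTemplate _ _ _ _ _; set T' := FrameTemplate _ _ _ _ _.
move=> DD' [B [delta [k [c Hp]]]]; have [dP kY kL c0 _] := Hp.
have /fin_all_exists[delta' /all_and2[dP' /fin_all_exists[o oP]]] b :
    exists d', d' \in D' /\ exists o : X -> F,
     (forall t, delta b t = d' t + \sum_x o x * A x t) /\
     (forall l, l \in L -> \sum_x o x * l x = 0).
  by have [d' dD oP] := DD' _ (dP b); exists d'.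
(* The multiples of rows of $A_1$ taken out of [delta] reappear as coefficients on [X]. This can be
   undone because [u] is unchanged. *)
pose shift (w : X -> F) (u : B -> F) x := w x + \sum_b u b * o b x.
have shE w u (f : X -> F) : \sum_x shift w u x * f x =
    \sum_x w x * f x + \sum_b u b * \sum_x o b x * f x.
  rewrite /shift; under eq_bigr do rewrite mulrDl mulr_suml.
  rewrite big_split /= exchange_big /=; congr (_ + _); apply: eq_bigr => b _.
  by rewrite mulr_sumr; apply: eq_bigr => x _; rewrite mulrA.
have colE w u (t : tcol T) :
    @col_val F T B delta w u t = @col_val F T' B delta' (shift w u) u t.
  rewrite /col_val /= shE -addrA; congr (_ + _); rewrite -big_split /=.
  by apply: eq_bigr => b _; rewrite (oP b).1 addrC mulrDr.
have eltE w u e : @elt_val F T B delta w u (k e) = @elt_val F T' B delta' (shift w u) u (k e).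
  case Ek: (k e) => [y|[[l g]|[b y]]] /=; first exact: colE.
    congr (_ + _); rewrite shE [X in _ + X]big1 ?addr0 // => b _.
    by rewrite (oP b).2 ?mulr0 //; have [] := kL _ _ Ek.
  by congr (_ + _); apply: colE.
exists B, delta', k, c; apply: (presented_by_transfer Hp) => //.
- move=> w u wuC; exists (shift w u), u.
  by split=> [a|e]; [rewrite -(wuC a) colE|rewrite eltE].
- move=> w' u wuC; pose w x := w' x - \sum_b u b * o b x.
  have colE' t : @col_val F T' B delta' w' u t = @col_val F T' B delta' (shift w u) u t.
    by congr (_ + _); apply: eq_bigr => x _; rewrite /shift subrK.
  exists w, u; split=> [a|e]; first by rewrite colE -colE' wuC.
  rewrite eltE; congr (_ * _); case: (k e) => [y|[[l g]|[b y]]] /=; first exact: colE'.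
    by congr (_ + _); apply: eq_bigr => x _; rewrite /shift subrK.
  by congr (_ + _); apply: colE'.
Qed.

Lemma presented_delta_sub (M : rep_matroid F) : D \subset D' ->
  presented (FrameTemplate A D1 D2 L1 L2) M ->
  presented (FrameTemplate A D1' D2' L1 L2) M.
Proof.
move=> /subsetP sDD; apply: presented_delta_change => d /sDD dD'.
exists d => //; exists (fun=> 0); split=> [t|l _]; rewrite big1 ?addr0 // => x _; exact: mul0r.
Qed.

End DeltaChange.

End TemplateMoves.

(** * Free families, additive subgroups and invariant complements *)

Section LinearAlgebra.
Local Open Scope ring_scope.

(** Greedy: a member of [s] already in the span is skipped, any other is appended. Since [t] stays
    in front, its coordinates are the initial ones. *)
Lemma extend_free (K : fieldType) (V : vectType K) (s t : seq V) : free t ->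
  exists r, [/\ {subset r <= s}, free (t ++ r) &
                {subset s <= <<t ++ r>>%VS}].
Proof.
elim: s t => [|x s IHs] t ft; first by exists [::]; split; rewrite ?cats0.
have [xt|xt] := boolP (x \in <<t>>%VS).
  have [r [rs fr sr]] := IHs t ft; exists r; split=> // y.
    by move/rs; rewrite inE orbC => ->.
  rewrite inE => /predU1P[->|/sr //]; rewrite span_cat.
  exact: subvP (addvSl _ _) _ xt.
have [|r [rs fr sr]] := IHs (rcons t x).
  rewrite -cats1 (perm_free (permEl (perm_catC _ _))) /= free_cons xt //.
exists (x :: r); rewrite -cat_rcons; split=> // y; rewrite inE => /predU1P[->|].
- exact: mem_head.
- by move/rs; rewrite inE orbC => ->.
- by apply: memv_span; rewrite mem_cat mem_rcons mem_head.
- exact: sr.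
Qed.

Variable F : finFieldType.

Lemma sum_fiber_scale (I J : finType) (V : lmodType F) (g : J -> I) (k : J -> F)
    (f : I -> V) :
  \sum_i (\sum_(j | g j == i) k j) *: f i = \sum_j k j *: f (g j).
Proof.
rewrite [RHS](partition_big g predT) //=; apply: eq_bigr => i _.
by rewrite scaler_suml; apply: eq_bigr => j /eqP ->.
Qed.

Lemma mem_span_image (V : vectType F) (I : finType) (S : {set I}) (f : I -> V) v :
  v \in <<[seq f i | i in S]>>%VS ->
  exists2 o : I -> F, (forall i, i \notin S -> o i = 0) & v = \sum_i o i *: f i.
Proof.
move/(coord_span (X := image_tuple f (mem S))) => vE.
exists (fun i => \sum_(j | enum_val j == i) coord (image_tuple f (mem S)) j v).
  by move=> i iS; rewrite big1 // => j /eqP ij; rewrite -ij enum_valP in iS.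
rewrite sum_fiber_scale {1}vE; apply: eq_bigr => j _; by rewrite nth_image.
Qed.

Lemma free_image (V : vectType F) (I : finType) (S : {set I}) (f : I -> V) :
  (forall o : I -> F, (forall i, i \notin S -> o i = 0) ->
     \sum_i o i *: f i = 0 -> forall i, o i = 0) ->
  free [seq f i | i in S].
Proof.
move=> fS; apply/(@freeP _ _ _ (image_tuple f (mem S))) => k k0 j.
pose o i := \sum_(j | enum_val j == i) k j.
have oj : o (enum_val j) = k j.
  by rewrite /o (big_pred1 j) // => j'; apply: inj_eq enum_val_inj _ _.
rewrite -oj; apply: fS => [i iS|].
  by rewrite /o big1 // => j' /eqP ij; rewrite -ij enum_valP in iS.
by rewrite sum_fiber_scale -[RHS]k0; apply: eq_bigr => j' _; rewrite nth_image.
Qed.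

Lemma add_subgroupN (E : finType) (S : {set vec F E}) u :
  add_subgroup S -> u \in S -> - u \in S.
Proof. by move=> [S0 SB] uS; rewrite -sub0r SB. Qed.

Lemma add_subgroupD (E : finType) (S : {set vec F E}) u v :
  add_subgroup S -> u \in S -> v \in S -> u + v \in S.
Proof. by move=> Sg uS vS; rewrite -[v]opprK Sg.2 // add_subgroupN. Qed.

Lemma add_subgroup_sum (E I : finType) (S : {set vec F E}) (f : I -> vec F E) :
  add_subgroup S -> (forall i, f i \in S) -> \sum_i f i \in S.
Proof.
move=> Sg fS; elim/big_ind: _ => // [|u v]; [exact: Sg.1|exact: add_subgroupD].
Qed.

Lemma add_subgroup_natmul (E : finType) (S : {set vec F E}) u n :
  add_subgroup S -> u \in S -> n%:R *: u \in S.
Proof.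
move=> Sg uS; rewrite scaler_nat; elim: n => [|n IHn]; first by rewrite mulr0n Sg.1.
by rewrite mulrS add_subgroupD.
Qed.

(** Scaling by [a] injects the finite set [S] into itself, hence is onto. *)
Lemma scale_invariantV (E : finType) (S : {set vec F E}) (a : F) : a != 0 ->
  (forall u, u \in S -> a *: u \in S) -> forall u, u \in S -> a^-1 *: u \in S.
Proof.
move=> a0 aS u uS; have : u \in [set a *: v | v in S].
  suff -> : [set a *: v | v in S] = S by [].
  apply/eqP; rewrite eqEcard card_imset ?leqnn ?andbT; last exact: scalerI.
  by apply/subsetP => _ /imsetP[v vS ->]; apply: aS.
by case/imsetP => v vS ->; rewrite scalerA mulVf ?scale1r.
Qed.

(* A maximal invariant subgroup of [D] skew to [W] is a complement: the scalars
   preserving it and [D] form a subfield containing [G]. *)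
Lemma skew_complement (G : {group {unit F}}) (E : finType) (D : {set vec F E})
    (W : {vspace vec F E}) : add_subgroup D -> scale_closed G D ->
  exists D' : {set vec F E}, [/\ add_subgroup D', scale_closed G D', D' \subset D,
    forall d, d \in W -> d \in D' -> d = 0 &
    forall d, d \in D -> exists2 d', d' \in D' & d - d' \in W].
Proof.
move=> Dg DG.
(* The required properties in boolean form, so that a maximal set having them can be taken. *)
pose ok (S : {set vec F E}) := [&& S \subset D, 0 \in S,
  [forall u in S, forall v in S, u - v \in S],
  [forall g in G, forall u in S, val g *: u \in S] &
  [forall u in S, (u \in W) ==> (u == 0)]].
have okP S : reflect [/\ add_subgroup S, scale_closed G S, S \subset D &
                         forall d, d \in W -> d \in S -> d = 0] (ok S).
  apply: (iffP and5P) => [[SD S0 /forall_inP SB /forall_inP SG /forall_inP SW]|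
                          [[S0 SB] SG SD SW]]; split=> //.
  - by split=> // u v uS vS; have /forall_inP := SB _ uS; apply.
  - by move=> g u gG uS; have /forall_inP := SG _ gG; apply.
  - by move=> d dW /SW; rewrite dW => /eqP.
  - by apply/forall_inP => u uS; apply/forall_inP => v vS; apply: SB.
  - by apply/forall_inP => g gG; apply/forall_inP => u uS; apply: SG.
  - by apply/forall_inP => u uS; apply/implyP => uW; rewrite (SW u).
have ok0 : ok [set 0].
  apply/okP; split=> [|g u _||d _]; rewrite ?inE.
  - by split=> [|u v]; rewrite !inE // => /eqP-> /eqP->; rewrite subr0.
  - by move/eqP ->; rewrite scaler0.
  - by rewrite sub1set Dg.1.
  - by move/eqP.
have [S /maxsetP[/okP[Sg SG SD SW] Smax] _] := maxset_exists ok0.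
exists S; split=> // d dD; apply: NNPP => noS.
(* The scalars preserving both [S] and [D]. They include [G] and are closed under differences, so
   $S+Kd$ is again an invariant subgroup. *)
pose K a := [forall u in S, a *: u \in S] && [forall u in D, a *: u \in D].
have KP a : reflect ((forall u, u \in S -> a *: u \in S) /\
                     (forall u, u \in D -> a *: u \in D)) (K a).
  by apply: (iffP andP) => -[/forall_inP aS /forall_inP aD].
(* For $a\neq 0$, dividing by [a] would put [d] in $S+W$, which [noS] excludes. Hence adjoining $Kd$
   keeps the subgroup skew to [W]. *)
have notW s a : s \in S -> K a -> s + a *: d \in W -> s + a *: d = 0.
  move=> sS /KP[aS aD]; have [->|a0] := eqVneq a 0; first by rewrite scale0r addr0 => /SW ->.
  move=> saW; case: noS; exists (- (a^-1 *: s)).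
    by apply: add_subgroupN => //; apply: scale_invariantV.
  by rewrite opprK addrC -[d](scalerK a0) -scalerDr memvZ.
pose S2 := [set v | [exists s in S, exists a, K a && (v == s + a *: d)]].
have S2P v : reflect (exists s a, [/\ s \in S, K a & v = s + a *: d]) (v \in S2).
  rewrite inE; apply: (iffP exists_inP) => [[s sS /existsP[a /andP[Ka /eqP]]]|[s [a [sS Ka ->]]]].
    by exists s, a.
  by exists s => //; apply/existsP; exists a; rewrite Ka eqxx.
have sS2 : S \subset S2.
  apply/subsetP => s sS; apply/S2P; exists s, 0; rewrite scale0r addr0; split=> //.
  by apply/KP; split=> u _; rewrite scale0r ?Sg.1 ?Dg.1.
have okS2 : ok S2.
  apply/okP; split=> //.
  - split=> [|u v /S2P[s [a [sS /KP[aS aD] ->]]] /S2P[s' [a' [sS' /KP[aS' aD'] ->]]]].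
      by apply: (subsetP sS2); exact: Sg.1.
    apply/S2P; exists (s - s'), (a - a'); rewrite scalerBl addrACA -opprD; split=> //.
      exact: Sg.2.
    by apply/KP; split=> w wS; rewrite scalerBl ?Sg.2 ?Dg.2 ?aS ?aS' ?aD ?aD'.
  - move=> g v gG /S2P[s [a [sS /KP[aS aD] ->]]]; apply/S2P.
    exists (val g *: s), (val g * a); rewrite scalerDr scalerA; split=> //.
      exact: SG.
    by apply/KP; split=> w wS; rewrite -scalerA ?SG ?DG ?aS ?aD.
  - apply/subsetP => _ /S2P[s [a [sS /KP[aS aD] ->]]].
    by rewrite add_subgroupD ?aD // (subsetP SD).
  - by move=> _ /[swap] /S2P[s [a [sS Ka ->]]]; apply: notW.
(* By maximality [d] already lies in [S], and $d-d=0$ lies in [W]. *)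
case: noS; exists d; last by rewrite subrr mem0v.
rewrite -(Smax _ okS2 sS2); apply/S2P; exists 0, 1; rewrite scale1r add0r.
by split=> //; [exact: Sg.1|apply/KP; split=> u uS; rewrite scale1r].
Qed.

End LinearAlgebra.

(** * Reduction of templates with empty [C] *)

Section Reduction.
Local Open Scope ring_scope.
Variable F : finFieldType.

(** When [C] is empty, the conditions on [C] are void and any [Gamma]-invariant [Delta] has the
    required product form. What remains is the shape of [Lambda] and the freeness and skewness of
    the rows on $X_1$. *)
Lemma reduced_presentation (T : frame_template F) : (tC T -> False) ->
  exists T' : frame_template F, exists2 X0 : {set tX T'}, reduction_partition X0 &
    (tC T' -> False) /\ forall M, presented T M <-> presented T' M.
Proof.
case: T => G C X Y0 Y1 A D L D1 D2 L1 L2 /= noC.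
pose colA t : vec F X := [ffun x => A x t].
have [l [lL fl Ll]] := extend_free (enum L) (nil_free (vec F X)).
have [r [rA fb Ab]] := extend_free [seq colA t | t : (C + (Y0 + Y1))%type] fl.
rewrite /= in fl Ll; set b := l ++ r in fb Ab; pose n := size b; pose bt : n.-tuple (vec F X) := in_tuple b.
pose dlt x : vec F X := [ffun y => (y == x)%:R].
have dltE (v : vec F X) : v = \sum_x v x *: dlt x.
  apply/ffunP => y; rewrite sum_ffunE (bigD1 y) //= !ffunE eqxx.
  rewrite big1 ?addr0 => [|x nx]; first by rewrite /GRing.scale /= mulr1.
  by rewrite !ffunE eq_sym (negPf nx) scaler0.
(* [P] takes coordinates with respect to [b], and [Q] recombines the basis vectors. [Q] undoes [P]
   on the span of [b], which contains [L] and the columns of [A]. *)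
pose P (i : 'I_n) x := coord bt i (dlt x).
pose Q x (i : 'I_n) := (bt`_i : vec F X) x.
have PE (v : vec F X) i : \sum_x P i x * v x = coord bt i v.
  rewrite {2}[v]dltE linear_sum; apply: eq_bigr => x _.
  by rewrite linearZ /= mulrC.
have QE (v : vec F X) x : v \in <<b>>%VS -> v x = \sum_i Q x i * coord bt i v.
  move/(coord_span (X := bt)) => {1}->; rewrite sum_ffunE; apply: eq_bigr => i _.
  by rewrite ffunE /GRing.scale /= mulrC.
have bl : {subset L <= <<b>>%VS}.
  move=> v vL; rewrite span_cat; apply: subvP (addvSl _ _) _ _.
  by apply: Ll; rewrite mem_enum.
have cb (i j : 'I_n) : coord bt i bt`_j = (j == i)%:R.
  exact: coord_free.
pose X0 := [set i : 'I_n | (i < size l)%N].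
have Lcoord v i : v \in L -> i \notin X0 -> coord bt i v = 0.
  move=> vL; rewrite inE -leqNgt => li.
  have /(coord_span (X := in_tuple l)) -> : v \in <<l>>%VS by apply: Ll; rewrite mem_enum.
  rewrite linear_sum big1 // => j _; rewrite linearZ /=.
  have jn : (j < n)%N by rewrite /n size_cat ltn_addr.
  have := cb i (Ordinal jn); rewrite /= nth_cat ltn_ord => ->.
  by rewrite -val_eqE /= ltn_eqF ?mulr0 // (leq_trans (ltn_ord j)).
pose A' (i : 'I_n) t := coord bt i (colA t).
pose crd (v : vec F X) : vec F 'I_n := [ffun i => coord bt i v].
have crdB u v : crd (u - v) = crd u - crd v.
  by apply/ffunP => i; rewrite !ffunE linearB.
pose L' := [set crd v | v in L].
have L1' : add_subgroup L'.
  split=> [|_ _ /imsetP[u uL ->] /imsetP[v vL ->]].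
    apply/imsetP; exists 0; first exact: L1.1.
    by apply/ffunP => i; rewrite !ffunE linear0.
  by rewrite -crdB imset_f ?L1.2.
have L2' : scale_closed G L'.
  move=> g _ gG /imsetP[u uL ->]; apply/imsetP; exists (val g *: u); first exact: L2.
  by apply/ffunP => i; rewrite !ffunE linearZ.
pose W := <<[seq mx_row A' i | i in ~: X0]>>%VS.
have [D' [D1' D2' sD'D D'W DD']] := skew_complement W D1 D2.
pose T0 := FrameTemplate A D1 D2 L1 L2; pose T1 := FrameTemplate A' D1 D2 L1' L2'.
pose T2 := FrameTemplate A' D1' D2' L1' L2'.
have PA i t : A' i t = \sum_x P i x * A x t.
  by rewrite /A' -PE; apply: eq_bigr => x _; rewrite ffunE.
have QA x t : A x t = \sum_i Q x i * A' i t.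
  have := QE (colA t) x; rewrite ffunE; apply; apply: Ab.
  by apply/imageP; exists t.
have PmulE (v : vec F X) : [ffun i => \sum_x P i x * v x] = crd v.
  by apply/ffunP => i; rewrite !ffunE PE.
have QmulE (v : vec F X) : v \in L -> [ffun x => \sum_i Q x i * crd v i] = v.
  move=> vL; apply/ffunP => x; rewrite ffunE (QE v) ?bl //.
  by apply: eq_bigr => i _; rewrite ffunE.
exists T2, X0; last first.
  (* [T0] and [T1] differ by a change of rows. From [T1] to [T2], [Delta] shrinks modulo the rows on
     $X_1$, and the way back is an inclusion. *)
  split=> // M; apply: iff_trans (_ : presented T1 M <-> _).
    split; apply: presented_row_change; try exact: PA; try exact: QA.
    - by move=> v vL; rewrite PmulE imset_f.
    - move=> v vL x; rewrite -[in LHS](QmulE v vL) ffunE.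
      by apply: eq_bigr => i _; rewrite ffunE PE.
    - by move=> _ /imsetP[v vL ->]; rewrite QmulE.
    - move=> _ /imsetP[v vL ->] i.
      rewrite ffunE -PE; apply: eq_bigr => x _; congr (_ * _).
      by rewrite -[in LHS](QmulE v vL) ffunE.
  split; last exact: presented_delta_sub.
  apply: presented_delta_change => d /DD'[d' d'D' ddW]; exists d' => //.
  have [o o0 oE] := mem_span_image ddW; exists o; split=> [t|_ /imsetP[v vL ->]].
    rewrite -[d](subrK d') oE addrC ffunE sum_ffunE; congr (_ + _).
    by apply: eq_bigr => i _; rewrite !ffunE.
  rewrite big1 // => i _; rewrite ffunE.
  have [iX|iX] := boolP (i \in X0); last by rewrite Lcoord ?mulr0.
  by rewrite o0 ?mul0r // inE iX.
split.
- exists [set pull inr d | d in D'].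
    split=> [|_ _ /imsetP[u uL ->] /imsetP[v vL ->]].
      by apply/imsetP; exists 0; rewrite ?linear0 ?D1'.1.
    by rewrite -linearB imset_f ?D1'.2.
  move=> d; split=> [dD'|[g [u [_ [gG _ /imsetP[w wD' ->] ->]]]]].
    exists 1%g, 0, (pull inr d); split=> //.
    + by apply/imsetP; exists d.
    + by apply/ffunP => -[c|y]; [case: (noC c)|rewrite !ffunE /= mul1r].
  apply: mem_congr (D2' _ _ gG wD'); apply/ffunP => -[c|y]; first by case: (noC c).
  by rewrite !ffunE.
- move=> u /fin_all_exists[m um].
  (* The first basis vectors lie in [Lambda] itself and not merely in its span, so their integer
     combinations stay in [Lambda] and realise every $\mathbb{F}_p$-vector on $X_0$. *)
  pose v := \sum_(i : {i | i \in X0}) (m i)%:R *: (bt`_(val i) : vec F X).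
  have vL : v \in L.
    apply: add_subgroup_sum => // i; apply: add_subgroup_natmul => //.
    have := valP i; rewrite inE => il; rewrite /= nth_cat il.
    by have := lL _ (mem_nth 0 il); rewrite mem_enum.
  exists (crd v); first exact: imset_f.
  apply/ffunP => i; rewrite coord_projE ffunE linear_sum (bigD1 i) //=.
  rewrite linearZ /= cb eqxx mulr1 -um big1 ?addr0 // => j nj.
  by rewrite linearZ /= cb (inj_eq val_inj) (negPf nj) mulr0.
- move=> _ /imsetP[v vL ->]; apply/ffunP => i; rewrite coord_projE !ffunE.
  by have := valP i; rewrite inE; apply: Lcoord.
- by move=> x c; case: (noC c).
- split=> //; apply: free_image => o o0 oE i.
  have [iX|iX] := boolP (i \in X0); first by rewrite o0 // inE iX.
  have := iX; rewrite inE -leqNgt => li.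
  (* A basis vector beyond those from [Lambda] is a column of [A]. In the same column of [A'] only
     row [i] is nonzero, so a relation between rows read there gives [o i = 0]. *)
  have : bt`_i \in [seq colA t | t : (C + (Y0 + Y1))%type].
    apply: rA; rewrite /= nth_cat ltnNge li /=; apply: mem_nth.
    by rewrite ltn_subLR // -size_cat.
  case/imageP => t _ iE; move/ffunP/(_ t): oE; rewrite sum_ffunE ffunE (bigD1 i) //=.
  rewrite !ffunE /= /A' -iE cb eqxx big1 ?addr0 => [|j nj].
    by rewrite /GRing.scale /= mulr1.
  by rewrite !ffunE /= /A' -iE cb eq_sym (negPf nj) scaler0.
Qed.

End Reduction.

(** * Contraction of [C] relative to a finite set of distinguished rows *)

Section Contraction.
Local Open Scope ring_scope.
Variables (F : finFieldType) (T : frame_template F).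

Section Contracted.
Variables (R : finType) (dR : R -> vec F (tcol T)).
Variables (S : finType) (sg : S -> loose T R).

(* A row combination is recorded by its coefficients on X, its coefficients on
   the distinguished rows R, and its total Delta-part over the other rows. *)
Definition row_data : finType := (tX T + (R + tcol T))%type.

Definition coefs (f : tX T -> F) (g : R -> F) (h : tcol T -> F) (j : row_data) : F :=
  match j with inl x => f x | inr (inl r) => g r | inr (inr t) => h t end.

Definition col_coefs t := coefs (fun x => tA1 x t) (fun r => dR r t) (fun t' => (t' == t)%:R).

Definition pairing (z c : row_data -> F) := \sum_j z j * c j.

Lemma pairingE z f g h : pairing z (coefs f g h) =
  \sum_x z (inl x) * f x + (\sum_r z (inr (inl r)) * g r + \sum_t z (inr (inr t)) * h t).
Proof. by rewrite /pairing !big_sumType. Qed.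

Lemma sum_delta (K : finType) (a : K) (f : K -> F) : \sum_k f k * (k == a)%:R = f a.
Proof.
rewrite (bigD1 a) //= eqxx mulr1 big1 ?addr0 // => k nk.
by rewrite (negPf nk) mulr0.
Qed.

(** All combinations of rows in [X] and [R] that vanish on [C] are taken as rows. Using all of them
    instead of a basis leaves the row space the same and avoids a choice. *)
Definition contracted_X : finType := {z : vec F row_data |
  [forall t, z (inr (inr t)) == 0] && [forall a, pairing z (col_coefs (col_C a)) == 0]}.
Definition contracted_Y0 : finType := (tY0 T + S)%type.
(** An added member [(l, (r, g))] is the part, on [X] and [R], of a frame column scaled to have
    entry 1 in a row outside [R]: [l] on [X] and $-g$ in row [r]. *)
Definition contracted_Y1 : finType :=
  (tY1 T + ({l : vec F (tX T) | l \in tLambda T} * (R * {g : {unit F} | g \in tGamma T})))%type.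
Local Notation col' := (void + (contracted_Y0 + contracted_Y1))%type.

(** The linear functional giving the entry of a row combination in each new column. A member of [S]
    of the form [(r, y)] is the unit vector of [r] plus column [y]. *)
Definition new_coefs (t : col') : row_data -> F :=
  match t with
  | inl _ => fun=> 0
  | inr (inl (inl y)) => col_coefs (inr (inl y))
  | inr (inl (inr s)) =>
      match sg s with
      | inl (l, g) => coefs l g (fun=> 0)
      | inr (r, y) => coefs (fun x => tA1 x (col_Y1 y))
          (fun r' => (r' == r)%:R + dR r' (col_Y1 y)) (fun t' => (t' == col_Y1 y)%:R)
      end
  | inr (inr (inl y)) => col_coefs (col_Y1 y)
  | inr (inr (inr (l, (r, g)))) =>
      coefs (val l) (fun r' => - val (val g) * (r' == r)%:R) (fun=> 0)
  end.

Definition contracted_A1 (z : contracted_X) (t : col') := pairing (val z) (new_coefs t).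

Definition row_eval (z : vec F row_data) : vec F col' := [ffun t => pairing z (new_coefs t)].

Definition admissible (z : vec F row_data) :=
  [&& [forall x, z (inl x) == 0],
      ([ffun t => z (inr (inr t))] : vec F (tcol T)) \in tDelta T &
      [forall a, pairing z (col_coefs (col_C a)) == 0]].

Definition contracted_Delta := [set row_eval z | z in admissible].

Definition restrict (l : vec F (tX T)) : vec F contracted_X :=
  [ffun z : contracted_X => \sum_x (val z : vec F row_data) (inl x) * l x].

Definition contracted_Lambda := [set restrict l | l in tLambda T].

Lemma pairingB (z z' : vec F row_data) c : pairing (z - z') c = pairing z c - pairing z' c.
Proof.
rewrite /pairing -sumrB; apply: eq_bigr => j _.
by rewrite !ffunE mulrBl.
Qed.

Lemma pairingZ a (z : vec F row_data) c : pairing (a *: z) c = a * pairing z c.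
Proof.
rewrite /pairing mulr_sumr; apply: eq_bigr => j _.
by rewrite !ffunE mulrA.
Qed.

Lemma admissibleP (z : vec F row_data) : reflect [/\ forall x, z (inl x) = 0,
     ([ffun t => z (inr (inr t))] : vec F (tcol T)) \in tDelta T &
     forall a, pairing z (col_coefs (col_C a)) = 0] (z \in admissible).
Proof.
apply: (iffP and3P) => [[/forallP z0 zD /forallP zC]|[z0 zD zC]]; split=> //.
- by move=> x; apply/eqP.
- by move=> x; apply/eqP.
- by apply/forallP => x; rewrite z0.
- by apply/forallP => x; rewrite zC.
Qed.

Lemma contracted_Delta_subgroup : add_subgroup contracted_Delta.
Proof.
split=> [|_ _ /imsetP[z /admissibleP[z0 zD zC] ->] /imsetP[z' /admissibleP[z0' zD' zC'] ->]].
  apply/imsetP; exists 0; last first.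
    by apply/ffunP => t; rewrite !ffunE /pairing big1 // => j _; rewrite ffunE mul0r.
  apply/admissibleP; split=> [x||a]; first by rewrite ffunE.
    by apply: mem_congr (tDelta_subgroup T).1; apply/ffunP => t; rewrite !ffunE.
  by rewrite /pairing big1 // => j _; rewrite ffunE mul0r.
apply/imsetP; exists (z - z'); last first.
  by apply/ffunP => t; rewrite !ffunE pairingB.
apply/admissibleP; split=> [x||a]; first by rewrite !ffunE z0 z0' subr0.
  by apply: mem_congr ((tDelta_subgroup T).2 _ _ zD zD'); apply/ffunP => t; rewrite !ffunE.
by rewrite pairingB zC zC' subr0.
Qed.

Lemma contracted_Delta_scale : scale_closed (tGamma T) contracted_Delta.
Proof.
move=> g _ gG /imsetP[z /admissibleP[z0 zD zC] ->].
apply/imsetP; exists (val g *: z); last first.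
  by apply/ffunP => t; rewrite !ffunE pairingZ.
apply/admissibleP; split=> [x||a]; first by rewrite !ffunE z0 scaler0.
  by apply: mem_congr (tDelta_scale gG zD); apply/ffunP => t; rewrite !ffunE.
by rewrite pairingZ zC mulr0.
Qed.

Lemma contracted_Lambda_subgroup : add_subgroup contracted_Lambda.
Proof.
split=> [|_ _ /imsetP[l lL ->] /imsetP[l' lL' ->]].
  apply/imsetP; exists 0; first exact: (tLambda_subgroup T).1.
  by apply/ffunP => z; rewrite !ffunE big1 // => x _; rewrite ffunE mulr0.
apply/imsetP; exists (l - l'); first exact: (tLambda_subgroup T).2.
apply/ffunP => z; rewrite !ffunE -sumrB; apply: eq_bigr => x _.
by rewrite !ffunE mulrBr.
Qed.

Lemma contracted_Lambda_scale : scale_closed (tGamma T) contracted_Lambda.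
Proof.
move=> g _ gG /imsetP[l lL ->]; apply/imsetP; exists (val g *: l).
  exact: tLambda_scale.
apply/ffunP => z; rewrite !ffunE /GRing.scale /= mulr_sumr; apply: eq_bigr => x _.
by rewrite !ffunE /GRing.scale /= mulrCA.
Qed.

Definition contracted : frame_template F :=
  @FrameTemplate F (tGamma T) void contracted_X contracted_Y0 contracted_Y1
    contracted_A1 contracted_Delta contracted_Lambda
    contracted_Delta_subgroup contracted_Delta_scale
    contracted_Lambda_subgroup contracted_Lambda_scale.

(** * Row combinations and columns of the two templates compared *)

Section Correspondence.
Variables (B : finType) (z : B -> vec F row_data) (delta' : B -> vec F (tcol contracted)).
Hypothesis zP : forall b, z b \in admissible.
Hypothesis dE : forall b, delta' b = row_eval (z b).

Definition dB b : vec F (tcol T) := [ffun t => z b (inr (inr t))].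

Definition full_delta (b : R + B) := match b with inl r => dR r | inr b => dB b end.

Definition glue (K : Type) (f : R -> K) (g : B -> K) (b : R + B) : K :=
  match b with inl r => f r | inr b => g b end.

(** Row data of the combination of new rows with coefficients [w'] and [u]. Its parts on [X] and
    [R], together with [u], are the coefficients [wX] and [uR] on the old rows. *)
Definition comb (w' : contracted_X -> F) (u : B -> F) (j : row_data) : F :=
  \sum_x w' x * val x j + \sum_b u b * z b j.

Definition wX w' u x := comb w' u (inl x).
Definition uR w' u := glue (fun r => comb w' u (inr (inl r))) u.

Lemma comb_col w' u t : comb w' u (inr (inr t)) = \sum_b u b * dB b t.
Proof.
rewrite /comb big1 ?add0r => [|x _]; first by apply: eq_bigr => b _; rewrite ffunE.
by have /andP[/forallP/(_ t)/eqP -> _] := valP x; rewrite mulr0.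
Qed.

Lemma pairing_comb w' u c :
  pairing (comb w' u) c = \sum_x w' x * pairing (val x) c + \sum_b u b * pairing (z b) c.
Proof.
rewrite /pairing /comb.
under eq_bigr do rewrite mulrDl !mulr_suml.
rewrite big_split exchange_big /= [X in _ + X]exchange_big /=.
by congr (_ + _); apply: eq_bigr => i _; rewrite mulr_sumr;
  apply: eq_bigr => j _; rewrite mulrA.
Qed.

Lemma col_val_new w' u (t : col') :
  @col_val F contracted B delta' w' u t = pairing (comb w' u) (new_coefs t).
Proof.
rewrite pairing_comb; congr (_ + _); apply: eq_bigr => b _.
by rewrite dE ffunE.
Qed.

Lemma pairing_col w' u t :
  pairing (comb w' u) (col_coefs t) = col_val full_delta (wX w' u) (uR w' u) t.
Proof.
rewrite pairingE /col_val; congr (_ + _); rewrite [RHS]big_sumType /=; congr (_ + _).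
by rewrite sum_delta comb_col.
Qed.

Lemma comb_C w' u a : col_val full_delta (wX w' u) (uR w' u) (col_C a) = 0.
Proof.
rewrite -pairing_col pairing_comb !big1 ?addr0 // => i _.
  by have /admissibleP[_ _ ->] := zP i; rewrite mulr0.
by have /andP[_ /forallP/(_ a)/eqP ->] := valP i; rewrite mulr0.
Qed.

(** Removing the contribution of the rows in [B] leaves row data without [Delta]-part that vanish on
    [C]. These are themselves a row of the contracted template, taken with coefficient 1. *)
Lemma comb_onto w u :
  (forall a, col_val full_delta w u (col_C a) = 0) ->
  exists w', wX w' (u \o inr) =1 w /\ uR w' (u \o inr) =1 u.
Proof.
move=> wuC; pose ub := u \o inr.
pose x0 : vec F row_data := [ffun j => match j with
  | inl x => w x
  | inr (inl r) => u (inl r) - \sum_b ub b * z b (inr (inl r))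
  | inr (inr t) => 0
  end].
have x0P : [forall t, x0 (inr (inr t)) == 0] &&
           [forall a, pairing x0 (col_coefs (col_C a)) == 0].
  apply/andP; split; first by apply/forallP => t; rewrite ffunE.
  apply/forallP => a; apply/eqP.
  have : pairing x0 (col_coefs (col_C a)) + \sum_b ub b * pairing (z b) (col_coefs (col_C a))
      = col_val full_delta w u (col_C a).
    rewrite pairingE /col_val [X in _ = _ + X]big_sumType /= -!addrA; congr (_ + _).
      by apply: eq_bigr => x _; rewrite ffunE.
    rewrite [X in _ + (X + _)]big1 ?add0r => [|t _]; last by rewrite ffunE mul0r.
    under [X in _ + X]eq_bigr do rewrite pairingE sum_delta.
    under [X in X + _]eq_bigr do rewrite ffunE mulrBl.
    rewrite sumrB -addrA; congr (_ + _).
    under [X in _ + X]eq_bigr => b _.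
      rewrite big1 ?add0r => [|x _]; last by have /admissibleP[-> _ _] := zP b; rewrite mul0r.
      rewrite mulrDr mulr_sumr; over.
    rewrite big_split /= exchange_big /= addrA addrC [X in _ + X](_ : _ = 0) ?addr0.
      by apply: eq_bigr => b _; rewrite ffunE.
    apply/eqP; rewrite addrC subr_eq0; apply/eqP; apply: eq_bigr => r _.
    by rewrite mulr_suml; apply: eq_bigr => b _; rewrite mulrA.
  rewrite wuC big1 ?addr0 // => b _; by have /admissibleP[_ _ ->] := zP b; rewrite mulr0.
pose x1 : contracted_X := exist _ x0 x0P.
have combE j : comb (fun x => (x == x1)%:R) ub j = x0 j + \sum_b ub b * z b j.
  congr (_ + _); under eq_bigr do rewrite mulrC.
  exact: (sum_delta x1 (fun x => val x j)).
exists (fun x => (x == x1)%:R); split=> [x|[r|b]] //=.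
  rewrite /wX combE ffunE big1 ?addr0 // => b _.
  by have /admissibleP[-> _ _] := zP b; rewrite mulr0.
by rewrite combE ffunE subrK.
Qed.

Definition lift_loose (l : loose T R) : loose T (R + B)%type :=
  match l with
  | inl (lam, g) => inl (lam, [ffun b => glue g (fun=> 0) b])
  | inr (r, y) => inr (inl r, y)
  end.

Lemma lift_loose_inj : injective lift_loose.
Proof.
move=> [[l g]|[r y]] [[l' g']|[r' y']] //= [-> // gg]; last by rewrite gg.
by congr (inl (_, _)); apply/ffunP => r; have /ffunP/(_ (inl r)) := gg; rewrite !ffunE.
Qed.

Lemma valid_lift_loose l : valid_loose (lift_loose l) <-> valid_loose l.
Proof.
case: l => [[l g]|[r y]] //=; apply: and_iff_compat_l; apply: iff_sym.
apply: (@frame_column_inj _ _ _ _ inl).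
- by move=> x y [].
- by move=> b; rewrite ffunE.
- by move=> [r|b]; rewrite ffunE /= ?eqxx // => _; exists r.
Qed.

(** The two labels describe the same column, under the correspondence of row combinations. *)
Definition related (k' : contracted_Y0 + loose contracted B)
    (k : tY0 T + loose T (R + B)%type) :=
  forall w' u, @elt_val F contracted B delta' w' u k' =
               elt_val full_delta (wX w' u) (uR w' u) k.

Lemma related_Y0 y : related (inl (inl y)) (inl y).
Proof. by move=> w' u; rewrite /= col_val_new pairing_col. Qed.

Lemma related_S s : related (inl (inr s)) (inr (lift_loose (sg s))).
Proof.
move=> w' u; rewrite /= col_val_new /= /lift_loose.
case: (sg s) => [[lam g]|[r y]] /=; rewrite pairingE.
  congr (_ + _); rewrite [RHS]big_sumType /=; congr (_ + _).
    by apply: eq_bigr => r _; rewrite ffunE.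
  rewrite !big1 // => i _; first by rewrite ffunE mulr0.
  exact: mulr0.
under [X in _ + (X + _)]eq_bigr do rewrite mulrDr.
rewrite big_split /= sum_delta -pairing_col pairingE /=.
by rewrite -[X in _ + X]addrA [LHS]addrCA.
Qed.

Lemma related_frame lam (g : vec F B) :
  related (inr (inl (restrict lam, g)))
          (inr (inl (lam, [ffun b => glue (fun=> 0) g b]))).
Proof.
move=> w' u /=; rewrite big_sumType /= [X in _ = _ + (X + _)]big1; last first.
  by move=> r _; rewrite ffunE mulr0.
rewrite add0r; congr (_ + _); last by apply: eq_bigr => b _; rewrite ffunE.
rewrite /wX /comb; under [RHS]eq_bigr => x _.
  rewrite [X in _ + X]big1 ?addr0 => [|b _].
    rewrite mulr_suml; over.
  by have /admissibleP[-> _ _] := zP b; rewrite mulr0.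
rewrite exchange_big; apply: eq_bigr => i _; rewrite ffunE mulr_sumr.
by apply: eq_bigr => x _; rewrite mulrA.
Qed.

Lemma related_Y1 b y : related (inr (inr (b, inl y))) (inr (inr (inr b, y))).
Proof. by move=> w' u; rewrite /= col_val_new pairing_col. Qed.

(** The unit vector of row [b] plus an added member of [Y1] is the frame column with 1 in row [b]
    and $-g$ in row [r]. *)
Lemma related_edge b lam r g :
  related (inr (inr (b, inr (lam, (r, g)))))
    (inr (inl (val lam, [ffun b' => glue (fun r' => - val (val g) * (r' == r)%:R)
                                         (fun b' => (b' == b)%:R) b']))).
Proof.
move=> w' u; rewrite /= col_val_new /= pairingE [X in _ = _ + X]big_sumType /=.
rewrite [X in _ + (_ + (_ + X))]big1 => [|t _]; last exact: mulr0.
rewrite addr0 addrCA; congr (_ + _); rewrite addrC; congr (_ + _).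
  by apply: eq_bigr => i _; rewrite ffunE.
under eq_bigr do rewrite ffunE /=.
exact/esym/sum_delta.
Qed.

End Correspondence.

(** The distinguished rows are put back and each row [b] keeps only its [Delta]-part. By [comb_C]
    and [comb_onto], the combinations of new rows are exactly the old combinations that vanish on
    [C]. *)
Lemma presented_contracted_sub M :
  (forall r, dR r \in tDelta T) -> (forall s, valid_loose (sg s)) ->
  presented contracted M -> presented T M.
Proof.
move=> dRD sgP [B [delta' [k' [c Hp]]]]; have [dP kY kL c0 _] := Hp.
have /fin_all_exists[z /all_and2[zP dE]] b :
    exists z, z \in admissible /\ delta' b = row_eval z.
  by have /imsetP[z zA ->] := dP b; exists z.
have kP e : exists k, [/\ related z delta' (k' e) k,
    forall l, k = inr l -> valid_loose l &
    forall y, k = inl y <-> k' e = inl (inl y)].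
  case Ek: (k' e) => [[y|s]|[[lam' g]|[b [y|[lam [r g]]]]]].
  - exists (inl y); split=> // [|y']; first exact: related_Y0.
    by split=> -[->].
  - exists (inr (lift_loose B (sg s))); split=> // [|l [<-]]; first exact: related_S.
    exact/valid_lift_loose.
  - have /= [/imsetP[lam lamL lamE] gP] := kL _ _ Ek; rewrite lamE.
    exists (inr (inl (lam, [ffun b => glue (fun=> 0) g b]))); split=> // [|l [<-]].
      exact: related_frame.
    split=> //; apply: (proj1 (@frame_column_inj F _ _ _ inr g _ _ _ _) gP).
    + by move=> x y [].
    + by move=> b; rewrite ffunE.
    + by move=> [r|b]; rewrite ffunE ?eqxx // => _; exists b.
  - exists (inr (inr (inr b, y))); split=> // [|l [<-] //]; exact: related_Y1.
  - eexists; split; [exact: related_edge|move=> l [<-]|by []].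
    split; first exact: valP.
    split.
      apply: leq_trans (_ : #|[set inl r; inr b]| <= 2)%N; last by rewrite cards2.
      apply: subset_leq_card; apply/subsetP => -[r'|b']; rewrite !inE ffunE /=.
        by have [->|_] := eqVneq r' r; rewrite ?eqxx // mulr0 eqxx.
      by have [->|_] := eqVneq b' b; rewrite eqxx ?orbT.
    move=> _; exists (inr b); first by rewrite ffunE /= eqxx.
    move=> [r'|b'] nb; rewrite ffunE /=.
      have [_|_] := eqVneq r' r; last by rewrite mulr0 eqxx.
      by exists (val g); rewrite ?mulr1 //; exact: valP.
    by have [bb|_] := eqVneq b' b; [rewrite bb eqxx in nb|rewrite eqxx].
have [k kE] := fin_all_exists kP.
exists (R + B)%type, (full_delta z), k, c; apply: (presented_by_transfer Hp) => //.
- move=> [r|b]; first exact: dRD.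
  by have /admissibleP[] := zP b.
- move=> y; have [e [ke ue]] := kY (inl y); exists e.
  split; first by have [_ _ kk] := kE e; apply/kk.
  by move=> e' ke'; apply: ue; have [_ _ kk] := kE e'; apply/kk.
- by move=> e l; have [_ + _] := kE e; apply.
- move=> w' u _; exists (wX z w' u), (uR z w' u); split; first exact: comb_C.
  by move=> e; congr (_ * _); have [+ _ _] := kE e; apply.
- move=> w u /(comb_onto zP)[w' [wE uE]]; exists w', (u \o inr); split=> // e.
  have [kk _ _] := kE e; rewrite [in RHS]kk; congr (_ * _).
  by apply: eq_elt_val.
Qed.

End Contracted.

Lemma presented_by_reindex (M : rep_matroid F) (B B' : finType) (h : B' -> B)
    (delta : B -> vec F (tcol T)) k (c : M -> F) :
  bijective h -> presented_by delta k c ->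
  exists k', @presented_by F T M B' (delta \o h) k' c.
Proof.
move=> hB Hp; have [g hK gK] := hB; have [dP kY kL c0 _] := Hp.
pose k' e : (tY0 T + loose T B')%type := match k e with
  | inl y => inl y
  | inr (inl (l, f)) => inr (inl (l, [ffun b => f (h b)]))
  | inr (inr (b, y)) => inr (inr (g b, y))
  end.
have kk e y : k' e = inl y <-> k e = inl y.
  by rewrite /k'; case: (k e) => [y'|[[l f]|[b y']]]; split=> // -[->].
have sumh (f : B -> F) : \sum_b f b = \sum_b' f (h b').
  by rewrite (reindex h) //; apply: onW_bij.
have valE w u e : elt_val delta w u (k e) = elt_val (delta \o h) w (u \o h) (k' e).
  have colE : col_val delta w u =1 col_val (delta \o h) w (u \o h).
    by move=> t; rewrite /col_val sumh.
  rewrite /k'; case: (k e) => [y'|[[l f]|[b y']]] /=; first exact: colE.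
    by rewrite sumh; congr (_ + _); apply: eq_bigr => b _; rewrite ffunE.
  by rewrite gK colE.
have colE w u t : col_val delta w u t = col_val (delta \o h) w (u \o h) t.
  by rewrite /col_val sumh.
exists k'; apply: (presented_by_transfer Hp) => // [b|y|e l|w u wuC|w u wuC].
- exact: dP.
- have [e [ke ue]] := kY y; exists e; split; first exact/kk.
  by move=> e' /kk /ue.
- rewrite /k'; case Ek: (k e) => [//|[[l' f]|[b y]]] [<-] //=.
  have [lL fP] := kL _ _ Ek; split=> //.
  apply: (proj2 (@frame_column_inj F _ _ _ h _ f _ _ _) fP).
  + exact: bij_inj.
  + by move=> b; rewrite ffunE.
  + by move=> b _; exists (g b); rewrite gK.
- exists w, (u \o h); split=> [a|e]; first by rewrite -colE.
  by rewrite valE.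
- have uE : (u \o g) \o h =1 u by move=> b; rewrite /= hK.
  exists w, (u \o g); split=> [a|e].
    by rewrite colE (eq_col_val (fun=> erefl) (fun=> erefl) uE).
  by rewrite valE (eq_elt_val (fun=> erefl) (fun=> erefl) uE).
Qed.

(** Proportional coordinates project the row space into a line, so the pair has rank at most 1. *)
Lemma simple_parallel (M : rep_matroid F) (e f : M) (a : F) :
  simple (underlying M) -> (forall v, v \in rspace M -> v f = a * v e) -> e = f.
Proof.
move=> [_ sM] par; apply/eqP/negPn/negP => ef; have := sM e f ef.
suff : (mrank ([set e; f] : {set underlying M}) <= 1)%N by move=> + E; rewrite E.
have eS : e \in [set e; f] by rewrite !inE eqxx.
pose q : vec F {x | x \in [set e; f]} := [ffun x => if val x == e then 1 else a].
apply: leq_trans (_ : \dim <[q]> <= 1)%N; last by rewrite dim_vline leq_b1.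
apply/dimvS/subvP => _ /memv_imgP[v vM ->].
apply/vlineP; exists (v e); apply/ffunP => x; rewrite coord_projE !ffunE.
have := valP x; rewrite !inE => /orP[]/eqP->; rewrite ?eqxx; first exact/esym/mulr1.
by rewrite eq_sym (negPf ef) par // mulrC.
Qed.

(** Every row in [B] repeats the [Delta]-part of a distinguished row, and subtracting that row
    clears it. Frame columns are then sorted by whether they meet [R], [B] or both. *)
Lemma presented_contracted (M : rep_matroid F) (R B : finType)
    (dR : R -> vec F (tcol T)) (rho : B -> R)
    (delta0 : R + B -> vec F (tcol T)) k (c : M -> F) :
  simple (underlying M) -> presented_by delta0 k c ->
  (forall r, delta0 (inl r) = dR r) -> (forall b, delta0 (inr b) = dR (rho b)) ->
  exists2 SS : {set loose T R}, (forall l, l \in SS -> valid_loose l) &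
    presented (contracted dR (fun s : {l | l \in SS} => val s)) M.
Proof.
move=> sM Hp dl dr; have [dP kY kL c0 vE] := Hp.
(* The columns supported on [R] that occur in [M]; they become members of the new [Y0]. *)
pose SS := [set l | [exists e, k e == inr (lift_loose B l)]].
exists SS => [l|]; first by rewrite inE => /existsP[e /eqP/kL/valid_lift_loose].
pose sg (s : {l | l \in SS}) : loose T R := val s.
pose T' := contracted dR sg; suff: presented T' M by [].
pose z (b : B) : vec F (tX T + (R + tcol T))%type := [ffun j => match j with
  | inl _ => 0 | inr (inl r) => - (r == rho b)%:R | inr (inr t) => delta0 (inr b) t end].
have zP b : z b \in admissible dR.
  apply/admissibleP; split=> [x||a]; first by rewrite ffunE.
    by apply: mem_congr (dP (inr b)); apply/ffunP => t; rewrite !ffunE.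
  rewrite pairingE big1 ?add0r => [|x _]; last by rewrite ffunE mul0r.
  under eq_bigr do rewrite ffunE mulNr mulrC.
  by rewrite sumrN !sum_delta ffunE dr addNr.
pose delta' b := row_eval dR sg (z b).
have dzE : full_delta dR z =1 delta0.
  move=> [r|b] /=; first by rewrite dl.
  by apply/ffunP => t; rewrite !ffunE.
(* The label comes with a scalar: the entry 1 of a frame column may lie in [R], while the new
   template needs it in [B]. *)
have kP e : exists ka : (tY0 T' + loose T' B) * F, [/\ ka.2 != 0,
    forall w' u, ka.2 * @elt_val F T' B delta' w' u ka.1
                 = elt_val (full_delta dR z) (wX z w' u) (uR z w' u) (k e),
    forall l, ka.1 = inr l -> valid_loose l,
    forall y, ka.1 = inl (inl y) <-> k e = inl y &
    forall s, ka.1 = inl (inr s) <-> k e = inr (lift_loose B (val s))].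
  have [l kl|nl] := pickP (fun l => k e == inr (lift_loose B l)).
    have lSS : l \in SS by rewrite inE; apply/existsP; exists e.
    exists (inl (inr (Sub l lSS)), 1); rewrite (eqP kl).
    split=> // [|w' u|s]; first exact: oner_neq0.
      by rewrite mul1r; apply: related_S.
    split=> [[<-] //|[/lift_loose_inj ll]].
    by congr (inl (inr _)); apply: val_inj.
  case Ek: (k e) => [y|[[lam g]|[[r|b] y]]]; last 1 first.
  - exists (inr (inr (b, inl y)), 1); split=> // [|w' u|l [<-] //|s]; first exact: oner_neq0.
      by rewrite mul1r; apply: related_Y1.
    by split=> //; rewrite /lift_loose; case: (val s) => [[]|[]].
  - exists (inl (inl y), 1); split=> // [|w' u|y'].
    + exact: oner_neq0.
    + by rewrite mul1r; apply: related_Y0.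
    + by split=> -[->].
  - have /= [lamL gF] := kL _ _ Ek.
    have notS (x : loose T' B) s : (inr x : (tY0 T' + loose T' B)%type) = inl (inr s) <->
        (inr (inl (lam, g)) : (tY0 T + loose T (R + B)%type)%type) = inr (lift_loose B (val s)).
      by split=> // E; have := nl (val s); rewrite Ek E eqxx.
    (* A frame column vanishing on [B] would be one of the lifted columns already treated. *)
    have [b gb] : exists b, g (inr b) != 0.
      apply: NNPP => nb; have := nl (inl (lam, [ffun r => g (inl r)])).
      rewrite Ek /= => /eqP; apply; congr (inr (inl (_, _))); apply/ffunP => -[r|b].
        by rewrite !ffunE /= ffunE.
      by rewrite ffunE /=; apply/eqP/negPn/negP => gb; apply: nb; exists b.
    have [[r gr]|nr] := classic (exists r, g (inl r) != 0); last first.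
      have g0 r : g (inl r) = 0.
        by apply/eqP/negPn/negP => gr; apply: nr; exists r.
      exists (inr (inl (restrict dR lam, [ffun b => g (inr b)])), 1).
      split=> // [|w' u|l [<-]|s]; first exact: oner_neq0.
      + rewrite mul1r (@related_frame R dR _ sg B z delta' zP).
        congr (elt_val _ _ _ (inr (inl (_, _)))); apply/ffunP => -[r|b'].
          by rewrite ffunE /= g0.
        by rewrite !ffunE /= ffunE.
      + split; first exact: imset_f.
        apply: (proj2 (@frame_column_inj F _ _ _ inr _ g _ _ _) gF).
        * by move=> ? ? [].
        * by move=> b'; rewrite ffunE.
        * by move=> [r|b'] gb'; [rewrite g0 eqxx in gb'|exists b'].
      + exact: notS.
    have supp b1 b2 : g b1 != 0 -> g b2 != 0 -> b1 != b2 ->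
        forall d, d != b1 -> d != b2 -> g d = 0 
      by move=> b10 b20 n12; apply: frame_column_support gF b10 b20 n12.
    have [|b1 b1E b1P] := gF.2; first by exists (inr b).
    (* A column with one entry [a] in [B] and one in [R]: dividing by [a] gives a unit vector plus
       an added member of [Y1]. *)
    have edge b0 r0 (h : {unit F}) (hG : h \in tGamma T) (l0 : vec F (tX T)) (l0L : l0 \in tLambda T) a :
        a != 0 -> (forall x, a * l0 x = lam x) ->
        g (inr b0) = a -> g (inl r0) = - (a * val h) ->
        exists ka : (tY0 T' + loose T' B) * F, [/\ ka.2 != 0,
          forall w' u, ka.2 * @elt_val F T' B delta' w' u ka.1
                 = elt_val (full_delta dR z) (wX z w' u) (uR z w' u) (inr (inl (lam, g))),
          forall l, ka.1 = inr l -> valid_loose l,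
          forall y, ka.1 = inl (inl y) <-> (inr (inl (lam, g)) : (tY0 T + loose T (R + B)%type)%type) = inl y &
          forall s, ka.1 = inl (inr s) <-> (inr (inl (lam, g)) : (tY0 T + loose T (R + B)%type)%type) = inr (lift_loose B (val s))].
      move=> a0 aE gb0 gr0.
      exists (inr (inr (b0, inr (exist _ l0 l0L, (r0, exist _ h hG)))), a).
      split=> // [w' u|l [<-] //|s]; last exact: notS.
      rewrite (@related_edge R dR _ sg B z delta' (fun=> erefl)) /= mulrDr !mulr_sumr; congr (_ + _).
        by apply: eq_bigr => x _; rewrite mulrCA aE.
      apply: eq_bigr => d _; rewrite mulrCA ffunE; congr (_ * _).
      have h0 : val h != 0 by apply: contraTneq (valP h) => ->; rewrite unitr0.
      have gd := @supp (inr b0) (inl r0); rewrite gb0 gr0 oppr_eq0 mulf_neq0 // in gd.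
      case: d => [r'|b'] /=.
        have [->|nr] := eqVneq r' r0; first by rewrite mulr1 mulrN.
        by rewrite !mulr0 gd.
      have [->|nb] := eqVneq b' b0; first by rewrite mulr1.
      by rewrite mulr0 gd.
    case: b1 b1E b1P => [r1|b1] b1E b1P.
      (* Here the 1 lies in [R] and the entry in [B] is $-h$, so the column is divided by $-h$ and
         $h^{-1}$ takes the place of [h]. *)
      have [//||h hG hE] := b1P (inr b); first by [].
      have h0 : val h != 0 by apply: contraTneq (valP h) => ->; rewrite unitr0.
      apply: (edge b r1 h^-1%g _ (- (val h)^-1 *: lam) _ (- val h)).
      + by rewrite groupV.
      + rewrite scaleNr add_subgroupN //; first exact: tLambda_subgroup.
        by rewrite -FinRing.val_unitV; apply: tLambda_scale; rewrite ?groupV.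
      + by rewrite oppr_eq0.
      + by move=> x; rewrite ffunE /GRing.scale /= mulrA mulrNN divff ?mul1r.
      + by [].
      + by rewrite FinRing.val_unitV mulNr opprK divff.
    have [//||h hG hE] := b1P (inl r); first by [].
    apply: (edge b1 r h hG lam lamL 1) => //; first exact: oner_neq0.
    + by move=> x; rewrite mul1r.
    + by rewrite mul1r.
  - have := nl (inr (r, y)); by rewrite Ek eqxx.
have [ka kaP] := fin_all_exists kP.
exists B, delta', (fun e => (ka e).1), (fun e => c e * (ka e).2).
apply: (presented_by_transfer Hp).
- by move=> b; apply: imset_f.
- move=> [y|s].
    have [e [ke ue]] := kY y; exists e; split; first by have [_ _ _ kk _] := kaP e; apply/kk.
    by move=> e' ke'; apply: ue; have [_ _ _ kk _] := kaP e'; apply/kk.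
  have := valP s; rewrite inE => /existsP[e /eqP ke]; exists e; split.
    by have [_ _ _ _ kk] := kaP e; apply/kk.
  move=> e' ke'; have [_ _ _ _ kk] := kaP e'; move/kk: ke' => ke'.
  (* Two elements with the same column supported on [R] would be parallel, so simplicity gives the
     uniqueness required of labels in [Y0]. *)
  apply: (simple_parallel (a := c e' / c e) sM) => v /vE[w [u [_ wuE]]].
  by rewrite !wuE ke ke' mulrA divfK.
- by move=> e l; have [_ _ + _ _] := kaP e; apply.
- by move=> e; have [ka0 _ _ _ _] := kaP e; rewrite mulf_neq0.
- move=> w u wuC.
  have [|w' [wE uE]] := comb_onto zP (w := w) (u := u).
    by move=> a; rewrite (eq_col_val dzE (fun=> erefl) (fun=> erefl)).
  exists w', (u \o inr); split=> [[]|e].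
  have [_ kE _ _ _] := kaP e; rewrite -mulrA kE; congr (_ * _).
  exact/esym/eq_elt_val.
- move=> w' u _; exists (wX z w' u), (uR z w' u); split=> [a|e].
    by rewrite -(eq_col_val dzE (fun=> erefl) (fun=> erefl)) comb_C.
  have [_ kE _ _ _] := kaP e; rewrite -mulrA kE; congr (_ * _).
  exact: eq_elt_val.
Qed.

(** One row is chosen for each vector of [Delta] that occurs; all other rows repeat these. The pair
    [D], [SS] ranges over a finite set determined by [T] alone, so finitely many templates
    suffice. *)
Lemma presented_some_contracted (M : rep_matroid F) :
  simple (underlying M) -> presented T M ->
  exists (D : {set vec F (tcol T)}) (SS : {set loose T {d | d \in D}}),
    [/\ D \subset tDelta T, forall l, l \in SS -> valid_loose l &
        presented (contracted (fun d : {d | d \in D} => val d)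
                              (fun s : {l | l \in SS} => val s)) M].
Proof.
move=> sM [B [delta [k [c Hp]]]]; have [dP _ _ _ _] := Hp.
pose D := [set delta b | b : B]; pose R : finType := {d | d \in D}.
have /fin_all_exists[rep repE] (r : R) : exists b, delta b = val r.
  by have /imsetP[b _ ->] := valP r; exists b.
pose B' : finType := {b | b \notin codom rep}.
pose h (b : R + B') := match b with inl r => rep r | inr b => val b end.
have hB : bijective h.
  have hI : injective h.
    move=> [r|b] [r'|b'] /= E.
    - by congr inl; apply: val_inj; rewrite -!repE E.
    - by have := valP b'; rewrite /= -E codom_f.
    - by have := valP b; rewrite /= E codom_f.
    - by congr inr; apply: val_inj.
  have /fin_all_exists[g gK] b : exists b', h b' = b.
    have [/codomP[r ->]|nb] := boolP (b \in codom rep); first by exists (inl r).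
    by exists (inr (Sub b nb)).
  by exists g => // b; apply: hI; rewrite gK.
have [k' Hp'] := presented_by_reindex hB Hp.
pose rho (b : B') : R := exist _ (delta (val b)) (imset_f delta (isT : val b \in B)).
have [|//|SS SSv pSS] := presented_contracted (rho := rho) sM Hp' (dR := fun d => val d).
  exact: repE.
exists D, SS; split=> //; apply/subsetP => _ /imsetP[b _ ->]; exact: dP.
Qed.

End Contraction.

(** * Small cocircuits and the refinement of a template *)

Section Refinement.
Local Open Scope ring_scope.
Variable F : finFieldType.

Lemma lker_coord_projT (E : finType) : lker (coord_proj F [set: E]) = 0%VS.
Proof.
apply/vspaceP => u; rewrite memv0; apply/mem_ker_coord_proj/eqP => [u0|-> e _].
  by apply/ffunP => e; rewrite u0 ?inE ?ffunE.
by rewrite ffunE.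
Qed.

Lemma rep_rankT (M : rep_matroid F) : rep_rank [set: M] = \dim (rspace M).
Proof. by apply: limg_dim_eq; rewrite lker_coord_projT capv0. Qed.

Lemma rep_rank_lt (M : rep_matroid F) (S : {set M}) (v : vec F M) :
  v \in rspace M -> v != 0 -> (forall e, e \in S -> v e = 0) ->
  (rep_rank S < rep_rank [set: M])%N.
Proof.
move=> vM v0 vS; rewrite rep_rankT -(limg_ker_dim (coord_proj F S) (rspace M)).
rewrite -[X in (X < _)%N]add0n ltn_add2r lt0n dimv_eq0; apply: contraNneq v0 => K0.
rewrite -memv0 -K0 memv_cap vM; exact/mem_ker_coord_proj.
Qed.

Lemma spans_or_vector (M : rep_matroid F) (S : {set M}) :
  @mspans (underlying M) S \/
  exists v, [/\ v \in rspace M, v != 0 & forall e, e \in S -> v e = 0].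
Proof.
pose K := (rspace M :&: lker (coord_proj F S))%VS.
have [K0|K0] := eqVneq K 0%VS; [left|right].
  rewrite /mspans /mfull_rank /= rep_rankT; exact: limg_dim_eq.
have : vpick K \in K := memv_pick K; rewrite memv_cap => /andP[vM vS].
by exists (vpick K); split; rewrite ?vpick0 //; apply/mem_ker_coord_proj.
Qed.

(** The complement of [S] does not span, so [S] contains a cocircuit; minimality of [S] is not
    imposed. *)
Definition small_cocircuit N (M : rep_matroid F) :=
  exists S : {set M}, [/\ (0 < #|S|)%N, (#|S| <= N)%N &
                          (rep_rank (~: S) < rep_rank [set: M])%N].

Lemma small_cocircuit_le N N' M : (N <= N')%N ->
  small_cocircuit N M -> small_cocircuit N' M.
Proof. by move=> NN [S [S0 SN rS]]; exists S; rewrite (leq_trans SN). Qed.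

(* A row combination on X_1 that vanishes on Y_1 vanishes outside Y_0. *)
Lemma unspanned_small_cocircuit (T : frame_template F) (X0 : {set tX T}) M :
  (tC T -> False) -> reduction_partition X0 -> presented T M ->
  @mspans (underlying (mx_matroid
              (fun (x : {x | x \in ~: X0}) y => tA1 (val x) (inr y))))
      [set inr y | y : tY1 T] \/
  small_cocircuit #|tY0 T| M.
Proof.
move=> noC [_ _ LX _ _] [B [delta [k [c [dP kY kL c0 vE]]]]].
have [//|] := spans_or_vector (M := mx_matroid
              (fun (x : {x | x \in ~: X0}) y => tA1 (val x) (inr y)))
      [set inr y | y : tY1 T]; first by left.
move=> [v0 [/mem_mx_matroid[o oE] v00 v0Y]]; right.
pose w (x : tX T) : F := \sum_(x' : {x | x \in ~: X0} | val x' == x) o x'.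
have wE (f : tX T -> F) : \sum_x w x * f x = \sum_x' o x' * f (val x').
  exact: (sum_fiber_scale (V := F^o) val o f).
have colE t : col_val delta w (fun=> 0) t = \sum_x' o x' * tA1 (val x') t.
  by rewrite /col_val wE [X in _ + X]big1 ?addr0 // => b _; rewrite mul0r.
pose v : vec F M := [ffun e => c e * elt_val delta w (fun=> 0) (k e)].
have vM : v \in rspace M.
  apply/vE; exists w, (fun=> 0); split=> [a|e]; first by case: (noC a).
  by rewrite ffunE.
have /fin_all_exists[eps epsE] := kY.
have epsK y : k (eps y) = inl y by have [] := epsE y.
(* The support of [v] lies in [Y0]: frame columns give 0 because [Lambda] vanishes on $X_1$, and
   columns of [Z] because the combination vanishes on [Y1]. *)
exists [set e | v e != 0]; split.
- rewrite lt0n cards_eq0; apply: contraNneq v00 => S0; apply/eqP/ffunP => -[y|y].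
    have /setP/(_ (eps y)) := S0; rewrite !inE ffunE epsK mulf_eq0 (negPf (c0 _)) /=.
    by rewrite colE -oE => /negPn/eqP; rewrite ffunE.
  by rewrite v0Y ?ffunE //; apply: imset_f.
- rewrite -cardsT; apply: leq_trans (leq_imset_card eps _); apply: subset_leq_card.
  apply/subsetP => e; rewrite inE ffunE; case Ek: (k e) => [y|[[l g]|[b y]]].
  + by move=> _; apply/imsetP; exists y => //; have [_ /(_ _ Ek) ->] := epsE y.
  + rewrite /= wE !big1 ?addr0 ?mulr0 ?eqxx // => [b _|x _]; first by rewrite mul0r.
    have [lL _] := kL _ _ Ek; have /ffunP/(_ x) := LX _ lL.
    by rewrite coord_projE => ->; rewrite ffunE mulr0.
  + by rewrite /= colE -oE v0Y ?addr0 ?mulr0 ?eqxx //; apply: imset_f.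
- apply: (rep_rank_lt vM) => [|e]; last by rewrite !inE negbK => /eqP.
  apply: contraNneq v00 => vz; apply/eqP/ffunP => -[y|y].
    have /ffunP/(_ (eps y)) := vz; rewrite !ffunE epsK /= colE -oE => /eqP.
    by rewrite mulf_eq0 (negPf (c0 _)) => /eqP.
  by rewrite v0Y ?ffunE //; apply: imset_f.
Qed.

(** Contracted templates are indexed by the pairs [D], [SS]. Only for [good] pairs is the class
    known to lie inside that of [T]; other pairs contribute no template. A reduced template where
    [Y1] does not span is dropped, and its members fall under the cocircuit alternative. *)
Lemma template_refinement (T : frame_template F) :
  exists (I : finType) (Psi : I -> frame_template F) N,
  [/\ forall i, refined (Psi i),
      forall i M, template_class (Psi i) M -> template_class T M &
      forall M, simple (underlying M) -> template_class T M ->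
        (exists i, template_class (Psi i) M) \/ small_cocircuit N M].
Proof.
pose fam (D : {set vec F (tcol T)}) (SS : {set loose T {d | d \in D}}) :=
  contracted (fun d : {d | d \in D} => val d) (fun s : {l | l \in SS} => val s).
pose good (D : {set vec F (tcol T)}) (SS : {set loose T {d | d \in D}}) :=
  D \subset tDelta T /\ forall l, l \in SS -> valid_loose l.
pose K : finType := {D : {set vec F (tcol T)} & {set loose T {d | d \in D}}}.
have famP (i : K) : exists I : finType, exists (Psi : I -> frame_template F) N,
  [/\ forall i, refined (Psi i),
      forall i M, template_class (Psi i) M -> template_class T M &
      forall M, good (tag i) (tagged i) -> presented (fam (tag i) (tagged i)) M ->
        (exists i, template_class (Psi i) M) \/ small_cocircuit N M].
  case: (classic (good (tag i) (tagged i))) => [gi|ngi]; last first.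
    by exists void, (of_void _), 0%N; split=> // -[].
  have [|T' [X0 redX0 [noC TT']]] := @reduced_presentation F (fam (tag i) (tagged i)); first by case.
  have sub M : template_class T' M -> template_class T M.
    move=> /template_class_presented/TT' HM; apply: presented_template_class.
    apply: presented_contracted_sub HM => [d|s].
      by have [/subsetP sD _] := gi; apply: sD; apply: valP.
    by have [_] := gi; apply; apply: valP.
  case: (classic (@mspans (underlying (mx_matroid
              (fun (x : {x | x \in ~: X0}) y => tA1 (val x) (inr y))))
      [set inr y | y : tY1 T'])) => [sp|nsp].
    exists unit, (fun=> T'), 0%N; split=> // [_|M _ /TT' HM]; first by exists X0.
    by left; exists tt; apply: presented_template_class.
  exists void, (of_void _), #|tY0 T'|; split=> [[]|[]|M _ /TT' HM].
  by case: (unspanned_small_cocircuit noC redX0 HM) => // HS; right.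
have [I /fin_all_exists[Psi /fin_all_exists[N NP]]] := fin_all_exists famP.
exists {i : K & I i}, (fun i => Psi (tag i) (tagged i)), (\max_i N i); split.
- by move=> [i j]; have [+ _ _] := NP i; apply.
- by move=> [i j] M; have [_ + _] := NP i; apply.
- move=> M sM /template_class_presented/(presented_some_contracted sM).
  move=> [D [SS [sD SSv HM]]].
  pose i : K := existT (fun D : {set vec F (tcol T)} => {set loose T {d | d \in D}}) D SS.
  have [_ _ /(_ M (conj sD SSv) HM)[[j jM]|cM]] := NP i; [left|right].
    by exists (existT (fun i => I i) i j).
  exact: small_cocircuit_le (leq_bigmax i) cM.
Qed.

End Refinement.

(** * Rank in the dual of a represented matroid *)

Section Duality.
Local Open Scope ring_scope.
Variable F : finFieldType.

(** The dual is the kernel of the pairing with a basis of the row space. That pairing is onto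
    because the matrix of the basis has a right inverse. *)
Lemma dim_rdual (M : rep_matroid F) : \dim (rspace (rdual M)) = (#|M| - \dim (rspace M))%N.
Proof.
pose d := \dim (rspace M); pose b := vbasis (rspace M).
have bB : basis_of (rspace M) b := vbasisP _.
pose phi (v : vec F M) : vec F 'I_d := [ffun i : 'I_d => \sum_e (b`_i : vec F M) e * v e].
have phi_lin : linear phi.
  move=> a u v; apply/ffunP => i; rewrite !ffunE.
  under eq_bigr do rewrite !ffunE mulrDr mulrCA.
  by rewrite big_split -mulr_sumr.
pose Phi : {linear vec F M -> vec F 'I_d} := HB.pack phi
   (GRing.isLinear.Build F (vec F M) (vec F 'I_d) _ phi phi_lin).
have kerE : lker (linfun Phi) = rspace (rdual M).
  apply/vspaceP => v; rewrite memv_ker mem_rdual lfunE /=.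
  apply/eqP/forall_inP => [v0 u uM|vM]; last first.
    apply/ffunP => i; rewrite !ffunE; apply/eqP/vM/(basis_mem bB)/mem_nth.
    by rewrite size_tuple.
  have uE e : u e = \sum_i coord b i u * (b`_i : vec F M) e.
    by rewrite {1}(coord_basis bB uM) sum_ffunE; apply: eq_bigr => i _; rewrite ffunE.
  rewrite /Defs.orthogonal; under eq_bigr do rewrite uE mulr_suml.
  rewrite exchange_big big1 //= => i _; have /ffunP/(_ i) := v0; rewrite !ffunE => E.
  under eq_bigr do rewrite -mulrA.
  by rewrite -mulr_sumr E mulr0.
have imE : limg (linfun Phi) = fullv.
  pose A := \matrix_(i < d, j < #|M|) (b`_i : vec F M) (enum_val j).
  have /row_freeP[B AB] : row_free A.
    apply: inj_row_free => r rA; apply/rowP => i; rewrite mxE.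
    move/basis_free/freeP: bB => /(_ (fun i => r 0 i)); apply.
    apply/ffunP => e; have /rowP/(_ (enum_rank e)) := rA.
    rewrite !mxE sum_ffunE ffunE => rE; rewrite -[RHS]rE; apply: eq_bigr => j _.
    by rewrite mxE enum_rankK ffunE.
  apply/vspaceP => t; rewrite memvf; apply/memv_imgP.
  exists [ffun e => \sum_j B (enum_rank e) j * t j]; first exact: memvf.
  apply/ffunP => i; rewrite lfunE /= !ffunE.
  under eq_bigr do rewrite ffunE mulr_sumr.
  rewrite exchange_big /=.
  transitivity (\sum_j (A *m B) i j * t j).
    rewrite AB (bigD1 i) //= mxE eqxx mul1r big1 ?addr0 // => j ji.
    by rewrite mxE eq_sym (negPf ji) mul0r.
  apply: eq_bigr => j _; rewrite mxE mulr_suml (reindex (@enum_rank M)) /=.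
    by apply: eq_bigr => e _; rewrite mxE enum_rankK mulrA.
  exact: (onW_bij _ (enum_rank_bij M)).
have := limg_ker_dim (linfun Phi) fullv.
by rewrite capfv kerE imE !dimvf !dim_vec card_ord => <-; rewrite addnK.
Qed.

(** Adding to the row space all vectors supported on [S] gives dimension $|S|+r(E-S)$. The
    orthogonal space consists of the dual vectors vanishing on [S], so counting dimensions gives the
    rank. *)
Lemma rep_rank_rdual (M : rep_matroid F) (S : {set M}) :
  @rep_rank F (rdual M) S = @dual_rank (underlying M) S.
Proof.
pose G := lker (coord_proj F (~: S)); pose N := @RepMatroid F M (rspace M + G)%VS.
have imE : limg (coord_proj F (~: S)) = fullv.
  apply/vspaceP => t; rewrite memvf; apply/memv_imgP.
  exists [ffun e => if insub e is Some x then t x else 0]; first exact: memvf.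
  by apply/ffunP => e; rewrite coord_projE ffunE valK.
have dG : \dim G = #|S|.
  have := limg_ker_dim (coord_proj F (~: S)) fullv.
  rewrite capfv imE !dimvf !dim_vec card_sig -/G -(cardsC S) => /eqP.
  by rewrite (eq_card (_ : [pred x in ~: S] =i ~: S)) ?eqn_add2r => [/eqP|e] //; rewrite inE.
have dN : \dim (rspace N) = (#|S| + @rep_rank F M (~: S))%N.
  rewrite -(limg_ker_dim (coord_proj F (~: S)) (rspace N)) -/G /= (capv_idPr (addvSr _ _)) dG.
  congr (_ + _)%N; rewrite limgD /rep_rank; congr (\dim _).
  by rewrite (_ : (_ @: G)%VS = 0%VS) ?addv0 //; apply/eqP; rewrite -lkerE.
have NE : rspace (rdual N) = (rspace (rdual M) :&: lker (coord_proj F S))%VS.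
  apply/vspaceP => v; rewrite memv_cap (@mem_rdual F N) (@mem_rdual F M).
  apply/forall_inP/andP => [vN|[/forall_inP vM /mem_ker_coord_proj vS] u /memv_addP[u1 u1M [u2 /mem_ker_coord_proj u2S ->]]].
    split; first by apply/forall_inP => u uM; apply: vN; apply: subvP (addvSl _ _) _ uM.
    apply/mem_ker_coord_proj => e eS.
    have := vN [ffun x => (x == e)%:R]; rewrite /Defs.orthogonal (bigD1 e) //= ffunE eqxx mul1r.
    rewrite big1 ?addr0 => [|x xe]; last by rewrite ffunE (negPf xe) mul0r.
    move=> H; apply/eqP/H; apply: subvP (addvSr _ _) _ _; apply/mem_ker_coord_proj => x.
    by rewrite inE ffunE; case: eqP => // ->; rewrite eS.
  rewrite /Defs.orthogonal; under eq_bigr do rewrite ffunE mulrDl.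
  rewrite big_split /= (eqP (vM _ u1M)) add0r big1 // => e _.
  have [eS|eS] := boolP (e \in S); first by rewrite vS ?mulr0.
  by rewrite u2S ?mul0r // inE.
have dNd := dim_rdual N; rewrite dN in dNd.
have arith (m r s q k : nat) : (m - (s + q) + k = m - r -> s + q <= m -> r <= m ->
    k = s + q - r)%N by lia.
rewrite /dual_rank /mfull_rank /= rep_rankT; apply: (arith #|M|).
- have := limg_ker_dim (coord_proj F S) (rspace (rdual M)).
  by rewrite -NE dNd dim_rdual.
- by rewrite -dN; apply: leq_trans (dimvS (subvf _)) _; rewrite dimvf dim_vec.
- by apply: leq_trans (dimvS (subvf _)) _; rewrite dimvf dim_vec.
Qed.

End Duality.

(** * Rank of minors, and minors of restrictions *)

Section Matroids.

Lemma mrank0 (M : matroid) : mrank (set0 : {set M}) = 0.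
Proof. by apply/eqP; rewrite -leqn0 -(cards0 M) mrank_card. Qed.

Lemma mdual_full_rank (M : matroid) : mfull_rank (mdual M) = #|M| - mfull_rank M.
Proof. by rewrite /mfull_rank /= /dual_rank setCT mrank0 addn0 cardsT. Qed.

Lemma mfull_rank_card (M : matroid) : mfull_rank M <= #|M|.
Proof. by rewrite -cardsT mrank_card. Qed.

Lemma matroid_iso_full_rank (M N : matroid) : matroid_iso M N -> mfull_rank M = mfull_rank N.
Proof.
move=> [f [g fK gK] fr]; rewrite /mfull_rank -fr; congr mrank.
by apply/setP => x; rewrite inE -[x]gK imset_f.
Qed.

Lemma has_minor_full_rank (M N : matroid) : has_minor M N -> mfull_rank N <= mfull_rank M.
Proof.
move=> [C [D [_ /matroid_iso_full_rank ->]]]; rewrite /mfull_rank /= /minor_rank.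
by apply: leq_trans (leq_subr _ _) _; apply: mrank_mono; apply: subsetT.
Qed.

(** The rank of [N] is the nullity of its dual, and nullity does not grow in passing to a minor. *)
Lemma has_minor_dual_full_rank (M N : matroid) :
  has_minor M (mdual N) -> mfull_rank N <= mfull_rank (mdual M).
Proof.
move=> [C [D [CD iso]]]; have := matroid_iso_full_rank iso.
rewrite !mdual_full_rank; have [f fB _] := iso.
have := bij_eq_card fB; rewrite /= card_sig => cN.
have cM : #|N| + (#|C| + #|D|) = #|M|.
  rewrite cN -cardsUI (eqP (_ : C :&: D == set0)) ?setI_eq0 // cards0 addn0.
  by rewrite -(cardsC (C :|: D)) addnC; congr (_ + _); apply: eq_card => x; rewrite !inE.
rewrite /mfull_rank /= /minor_rank.
set E := val @: _ => rE.
have arith (n m c d rN rM x rC : nat) : n - rN = x - rC -> n + (c + d) = m ->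
  rM <= x + d -> rC <= c -> rC <= x -> rN <= n -> rN <= m - rM by lia.
apply: arith rE cM _ (mrank_card C) (mrank_mono (subsetUr E C)) (mfull_rank_card N).
apply: leq_trans (mrankU_le _ _); apply: mrank_mono; apply/subsetP => x _.
rewrite !inE; have [xCD|xCD] := boolP (x \in C :|: D).
  by move: xCD; rewrite inE => /orP[->|->]; rewrite ?orbT.
by rewrite (_ : x \in E) //; apply/imsetP; exists (Sub x xCD).
Qed.

Section Restriction.
Variables (N N0 : matroid) (g : N0 -> N).
Hypothesis gI : injective g.
Hypothesis gr : forall S : {set N0}, mrank (g @: S) = mrank S.

(** The elements of [N] outside the image of [g] are deleted as well. *)
Lemma has_minor_restriction M : has_minor M N -> has_minor M N0.
Proof.
move=> [C [D [CD [f fB fr]]]]; have fI := bij_inj fB.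
pose V := [set val (f x) | x : N & x \notin codom g].
have fC x : val (f x) \notin C :|: D := valP (f x).
have hP y : val (f (g y)) \notin C :|: (D :|: V).
  rewrite setUA inE negb_or fC; apply/imsetP => -[x]; rewrite inE => xg /val_inj/fI gx.
  by rewrite -gx codom_f in xg.
exists C, (D :|: V); split.
  rewrite disjoint_sym -setI_eq0 setIUl setU_eq0 setI_eq0 disjoint_sym CD setI_eq0.
  apply/pred0P => e; apply/andP => -[/imsetP[x _ ->]] xC.
  by have := fC x; rewrite inE negb_or => /andP[/negP[]].
pose h y : mminor C (D :|: V) := exist _ (val (f (g y))) (hP y).
have hI : injective h by move=> y y' [] /val_inj/fI/gI.
exists h.
  have [fi _ fiK] := fB.
  have /fin_all_exists[k kK] n : exists y, h y = n.
    have : val n \notin (C :|: D) :|: V by rewrite -setUA; apply: valP n.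
    rewrite inE negb_or => /andP[nCD nV].
    pose x := fi (exist _ (val n) nCD).
    have xE : val (f x) = val n by rewrite /x fiK.
    have [/codomP[y xy]|xg] := boolP (x \in codom g).
      by exists y; apply: val_inj; rewrite -xE xy.
    by case/imsetP: nV; exists x; rewrite ?inE.
  by exists k => // y; apply: hI; rewrite kK.
move=> S; rewrite -gr -fr /= /minor_rank; congr (mrank (_ :|: _) - _).
by rewrite -!imset_comp.
Qed.

(** The dual of a restriction is a contraction of the dual, so here the elements outside the image
    of [g] are contracted. *)
Lemma has_minor_dual_restriction M : has_minor M (mdual N) -> has_minor M (mdual N0).
Proof.
move=> [C [D [CD [f fB fr]]]]; have fI := bij_inj fB.
pose T0 := ~: (g @: [set: N0]).
pose V := [set val (f x) | x in T0].
have fC x : val (f x) \notin C :|: D := valP (f x).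
have hP y : val (f (g y)) \notin (C :|: V) :|: D.
  rewrite setUAC inE negb_or fC; apply/imsetP => -[x]; rewrite inE => xg /val_inj/fI gx.
  by rewrite -gx imset_f in xg.
exists (C :|: V), D; split.
  rewrite -setI_eq0 setIUl setU_eq0 setI_eq0 CD setI_eq0.
  apply/pred0P => e; apply/andP => -[/imsetP[x _ ->]] xD.
  by have := fC x; rewrite inE negb_or => /andP[_ /negP[]].
pose h y : mminor (C :|: V) D := exist _ (val (f (g y))) (hP y).
have hI : injective h by move=> y y' [] /val_inj/fI/gI.
exists h.
  have [fi _ fiK] := fB.
  have /fin_all_exists[k kK] n : exists y, h y = n.
    have : val n \notin (C :|: D) :|: V by rewrite (setUAC C D V); apply: valP n.
    rewrite inE negb_or => /andP[nCD nV].
    pose x := fi (exist _ (val n) nCD).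
    have xE : val (f x) = val n by rewrite /x fiK.
    have [/imsetP[y _ xy]|xg] := boolP (x \in g @: [set: N0]).
      by exists y; apply: val_inj; rewrite -xE xy.
    by case/imsetP: nV; exists x; rewrite ?inE.
  by exists k => // y; apply: hI; rewrite kK.
have rE (X : {set N}) : mrank (val @: (f @: X) :|: C) = @dual_rank N X + mrank C.
  have := fr X; rewrite /= /minor_rank => <-.
  by rewrite subnK // mrank_mono // subsetUr.
move=> S; rewrite /= /minor_rank.
have -> : val @: (h @: S) = val @: (f @: (g @: S)) by rewrite -!imset_comp.
have -> : C :|: V = val @: (f @: T0) :|: C by rewrite setUC /V -imset_comp.
rewrite setUA -!imsetU.
rewrite !rE subnDr /dual_rank.
have -> : ~: (g @: S :|: T0) = g @: (~: S).
  apply/setP => x; rewrite !inE negb_or negbK; apply/andP/imsetP => [[xS /imsetP[y _ xy]]|[y yS ->]].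
    by exists y => //; rewrite inE; apply: contraNN xS => yS; rewrite xy imset_f.
  by split; [rewrite mem_imset //; move: yS; rewrite inE|rewrite imset_f].
rewrite setCK !gr cardsU (_ : _ :&: _ = set0) ?cards0 ?subn0; last first.
  apply/setP => x; rewrite !inE; apply/negP => /andP[/imsetP[y _ ->]].
  by rewrite imset_f.
rewrite (card_imset _ gI).
have arith (s t q rN r0 : nat) : r0 <= s + q -> rN <= t + r0 ->
  s + t + q - rN - (t + r0 - rN) = s + q - r0 by lia.
apply: arith; first exact: (@dual_rank_sub N0 S).
by have := @dual_rank_sub N T0; rewrite setCK gr.
Qed.

End Restriction.
End Matroids.

(** * Cycle matroids of complete graphs of different sizes *)

Section CompleteGraphs.

Lemma Kn_adj_sym n (S : {set Kn_edge n}) : connect_sym (Kn_adj S).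
Proof.
by apply: sym_connect_sym => u v /=; apply: eq_existsb => e; rewrite setUC.
Qed.

Lemma MK_full_rank n : n <= (mfull_rank (MK n)).+1.
Proof.
case: n => // n; suff c1 : n_comp (Kn_adj (setT : {set Kn_edge n.+1})) 'I_n.+1 = 1.
  by rewrite /mfull_rank /= /Kn_rank c1 subn1.
rewrite -[RHS](n_comp_connect (Kn_adj_sym (setT : {set Kn_edge n.+1})) ord0).
apply: eq_n_comp_r => v.
rewrite [RHS](_ : _ = true) //; have [->|uv] := eqVneq v ord0; first exact: connect0.
have cuv : #|[set ord0; v]| == 2 by rewrite cards2 (eq_sym ord0) uv.
by apply: connect1; apply/exists_inP; exists (exist _ [set ord0; v] cuv : Kn_edge n.+1).
Qed.

(** The $n'-n$ extra vertices are isolated in the image graph. Each adds one component, which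
    cancels the growth in the number of vertices. *)
Lemma MK_restriction n n' : n <= n' ->
  exists2 g : MK n -> MK n', injective g & forall S : {set MK n}, mrank (g @: S) = mrank S.
Proof.
move=> le; pose wd : 'I_n -> 'I_n' := widen_ord le.
have wI : injective wd by move=> i j /(congr1 val) /= /val_inj.
have gP (e : Kn_edge n) : #|wd @: val e| == 2 by rewrite card_imset // (valP e).
pose g (e : Kn_edge n) : Kn_edge n' := exist _ (wd @: val e) (gP e).
have gI : injective g by move=> e e' [] /(imset_inj wI)/val_inj.
exists g => // S; rewrite /= /Kn_rank.
set e' := Kn_adj (g @: S); pose a : pred 'I_n' := [pred i : 'I_n' | i < n].
have eP u v : e' u v -> exists2 x, u = wd x & exists2 y, v = wd y & Kn_adj S x y.
  case/exists_inP => _ /imsetP[e eS ->] /eqP /= eE.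
  have /imsetP[x xe ux] : u \in wd @: val e by rewrite eE !inE eqxx.
  have /imsetP[y ye vy] : v \in wd @: val e by rewrite eE !inE eqxx orbT.
  exists x => //; exists y => //; apply/exists_inP; exists e => //.
  by apply/eqP/(imset_inj wI); rewrite eE imsetU !imset_set1 ux vy.
have cl : closed e' a.
  by move=> u v /eP[x -> [y -> _]]; rewrite !inE /= !ltn_ord.
have := n_compC a e'.
(* Components among the first [n] vertices correspond along [wd]; the remaining vertices are counted
   apart. *)
rewrite (adjunction_n_comp wd (Kn_adj_sym _) (@Kn_adj_sym _ S) cl); last first.
  apply: strict_adjunction => //; first exact: Kn_adj_sym.
    apply/subsetP => u; rewrite inE => un; apply/codomP; exists (Ordinal un).
    exact: val_inj.
  move=> x y _; apply/idP/idP => [/eP[x' /wI -> [y' /wI -> //]]|].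
  case/exists_inP => e eS /eqP eE; apply/exists_inP; exists (g e); first exact: imset_f.
  by rewrite /= eE imsetU !imset_set1.
rewrite (eq_n_comp_r (_ : _ =i 'I_n)) => [->|x]; last by rewrite !inE /= ltn_ord.
have -> : n_comp e' [predC a] = n' - n.
  have : #|a| = n.
    rewrite -[RHS]card_ord -(card_codom wI); apply: eq_card => u; rewrite inE.
    apply/idP/codomP => [un|[x ->]]; last exact: (ltn_ord x).
    by exists (Ordinal un); apply: val_inj.
  have := cardC a; rewrite card_ord => cA aE.
  have arith (x y z w : nat) : x + y = w -> x = z -> y = w - z by lia.
  rewrite -(arith _ _ _ _ cA aE); apply: eq_card => u; rewrite !inE.
  case: ltnP => un; rewrite ?andbF ?andbT //=.
  have /connectP[p] := connect_root e' u; case: p => [|v p] /=.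
    by move=> _ E; apply/eqP.
  by case/andP => /eP[x ux _]; move: un; rewrite ux leqNgt /= ltn_ord.
have arith (x y : nat) : x = y + (n' - n) -> n' - x = n - y by lia.
exact: arith.
Qed.

Lemma has_minor_MK M n n' : n <= n' -> has_minor M (MK n') -> has_minor M (MK n).
Proof. by case/MK_restriction => g gI gr; apply: has_minor_restriction gr _. Qed.

Lemma has_minor_dual_MK M n n' :
  n <= n' -> has_minor M (mdual (MK n')) -> has_minor M (mdual (MK n)).
Proof. by case/MK_restriction => g gI gr; apply: has_minor_dual_restriction gr _. Qed.

End CompleteGraphs.

(** * Connectivity under duality, and against small cocircuits *)

Section Connectivity.
Variable F : finFieldType.
Implicit Type M : rep_matroid F.

Lemma simple_rdual M : simple (mdual (underlying M)) -> simple (underlying (rdual M)).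
Proof.
move=> [s1 s2]; split=> [e|e f ef]; rewrite /= rep_rank_rdual; first exact: s1.
exact: s2.
Qed.

Lemma vertically_connected_rdual M k :
  cyclically_connected (underlying M) k -> vertically_connected (underlying (rdual M)) k.
Proof.
move=> cM S; rewrite /mspans /mfull_rank /= !rep_rank_rdual; exact: (cM S).
Qed.

Lemma full_rank_rdual M :
  mfull_rank (underlying (rdual M)) = mfull_rank (mdual (underlying M)).
Proof. by rewrite /mfull_rank /= rep_rank_rdual. Qed.

(** The connectivity function $r(S)+r(E-S)-r(E)$ is the same for a matroid and its dual. *)
Lemma tutte_connected_rdual M k :
  tutte_connected (underlying M) k -> tutte_connected (underlying (rdual M)) k.
Proof.
move=> cM j S jk jS jS'; rewrite full_rank_rdual mdual_full_rank /= !rep_rank_rdual.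
have arith (x y z w r c : nat) : r + j <= x + y -> z + w = c -> r <= z + y -> r <= w + x ->
  r <= c -> c - r + j <= z + y - r + (w + x - r) by lia.
rewrite /dual_rank setCK; apply: arith (cM j S jk jS jS') (cardsC S) _ _ _.
- exact: (@dual_rank_sub (underlying M) S).
- by have := @dual_rank_sub (underlying M) (~: S); rewrite setCK.
- exact: (mfull_rank_card (underlying M)).
Qed.

(** A set of one or two elements that is dependent in the dual would give a separation of order at
    most 2; the bound $2k\le|M|$ makes its complement large enough. *)
Lemma tutte_connected_cosimple M k : 2 < k -> 2 * k <= #|M| ->
  tutte_connected (underlying M) k -> simple (mdual (underlying M)).
Proof.
move=> k2 kM cM.
have key (S : {set M}) : 0 < #|S| -> #|S| <= 2 -> @dual_rank (underlying M) S = #|S|.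
  move=> S0 S2; have := cM #|S| S; have : #|~: S| = #|M| - #|S| by rewrite -(cardsC S) addKn.
  have /= := @mrank_card (underlying M) S; have /= := @mrank_mono (underlying M) _ _ (subsetT (~: S)).
  rewrite /dual_rank /= -/(mfull_rank (underlying M)).
  have arith (s c x y r : nat) : y <= r -> x <= s -> 0 < s -> s <= 2 ->
    c = #|M| - s -> (0 < s < k -> s <= s -> s <= c -> r + s <= x + y) -> s + y - r = s.
    by move=> *; lia.
  by move=> h1 h2 h3; apply: arith h1 h2 S0 S2 h3.
split=> [e|e f ef] /=; rewrite key ?cards1 ?cards2 ?ef //.
Qed.

(** Since $r(S)\le|S|$ and $r(E-S)<r(E)$, the set [S] would give a separation of order $|S|\le
    N<k$. *)
Lemma tutte_connected_no_small_cocircuit M k N : N < k -> 2 * k <= #|M| ->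
  tutte_connected (underlying M) k -> ~ small_cocircuit N M.
Proof.
move=> Nk kM cM [S [S0 SN rS]]; have := cM #|S| S.
have : #|~: S| = #|M| - #|S| by rewrite -(cardsC S) addKn.
have /= := @mrank_card (underlying M) S; rewrite /mfull_rank /=.
have arith (s c x y r : nat) : 0 < s -> s <= N -> y < r -> x <= s ->
  c = #|M| - s -> (0 < s < k -> s <= s -> s <= c -> r + s <= x + y) -> False by lia.
exact: arith S0 SN rS.
Qed.

(** Neither side spans: [S] has rank at most [N], below the full rank, and its complement does not
    span by assumption. *)
Lemma vertically_connected_no_small_cocircuit M k N : N < k ->
  N < mfull_rank (underlying M) ->
  vertically_connected (underlying M) k -> ~ small_cocircuit N M.
Proof.
move=> Nk Nr cM [S [S0 SN rS]]; have := cM S; have /= := @mrank_card (underlying M) S.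
rewrite /mspans; move: Nr; rewrite /mfull_rank /=.
have arith (s x y r : nat) : 0 < s -> s <= N -> y < r -> N < r -> x <= s ->
  (x + y + 1 < r + k -> x = r \/ y = r) -> False by lia.
exact: arith S0 SN rS.
Qed.

Lemma family_refinement s (Phi : 'I_s -> frame_template F) :
  exists s' (Phi' : 'I_s' -> frame_template F) N,
  [/\ forall i, refined (Phi' i),
      forall i M, template_class (Phi' i) M -> exists j, template_class (Phi j) M &
      forall i M, simple (underlying M) -> template_class (Phi i) M ->
        (exists i', template_class (Phi' i') M) \/ small_cocircuit N M].
Proof.
have /fin_all_exists[I] i := template_refinement (Phi i).
move=> /fin_all_exists[Psi /fin_all_exists[N NP]].
pose J : finType := {i : 'I_s & I i}.
pose fam (j : J) := Psi (tag j) (tagged j).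
exists #|J|, (fun j => fam (enum_val j)), (\max_i N i); split.
- by move=> j; have [+ _ _] := NP (tag (enum_val j)); apply.
- move=> j M jM; exists (tag (enum_val j)).
  by have [_ + _] := NP (tag (enum_val j)); apply; apply: jM.
- move=> i M sM iM; have [_ _ /(_ M sM iM)[[j jM]|cM]] := NP i; [left|right].
    by exists (enum_rank (existT (fun i => I i) i j : J)); rewrite enum_rankK.
  exact: small_cocircuit_le (leq_bigmax i) cM.
Qed.

End Connectivity.

Theorem theorem5p6 (F : finFieldType) (p : nat) (hp : p \in [pchar F]%R)
    (m : nat) (hm : (0 < m)%N)
    (cM : rep_matroid F -> Prop) (hM : minor_closed cM) :
  ((exists (k s t : nat)
           (Phi : 'I_s -> frame_template F) (Psi : 'I_t -> frame_template F),
      [/\ (0 < k)%N, contains_classes cM Phi, contains_dual_classes cM Psi &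
          describes_connected cM Phi Psi m p k]) ->
   (exists (k s t : nat)
           (Phi : 'I_s -> frame_template F) (Psi : 'I_t -> frame_template F),
      [/\ (0 < k)%N, contains_classes cM Phi, contains_dual_classes cM Psi,
          describes_connected cM Phi Psi m p k & all_refined Phi Psi]))
  /\
  ((exists (k n s t : nat)
           (Phi : 'I_s -> frame_template F) (Psi : 'I_t -> frame_template F),
      [/\ (0 < k)%N && (0 < n)%N,
          contains_classes cM Phi, contains_dual_classes cM Psi,
          describes_vertically_connected cM Phi m p k n &
          describes_cyclically_connected cM Psi m p k n]) ->
   (exists (k n s t : nat)
           (Phi : 'I_s -> frame_template F) (Psi : 'I_t -> frame_template F),
      [/\ (0 < k)%N && (0 < n)%N,
          contains_classes cM Phi /\ contains_dual_classes cM Psi,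
          describes_vertically_connected cM Phi m p k n,
          describes_cyclically_connected cM Psi m p k n &
          all_refined Phi Psi])).
Proof.
split=> [[k [s [t [Phi [Psi [k0 c1 c2 d]]]]]]|[k [n [s [t [Phi [Psi [/andP[k0 n0] c1 c2 d1 d2]]]]]]]].
  have [s' [Phi' [N [rf sub cov]]]] := family_refinement Phi.
  have [t' [Psi' [N' [rf' sub' cov']]]] := family_refinement Psi.
  (* The constant exceeds both cocircuit bounds, and the summand 3 ensures [2 < k'], as needed for
     cosimplicity. *)
  pose k' := (k + N + N' + 3)%N; have kk' : (k <= k')%N by rewrite /k'; lia.
  exists k', s', t', Phi', Psi'; split=> //.
  - by rewrite /k'; lia.
  - by move=> i M /sub[j]; apply: c1.
  - by move=> i M /sub'[j]; apply: c2.
  move=> M MM sM cn kM noPG.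
  have [||[i iM]|[j jM]] := d M MM sM _ _ noPG.
  - by move=> j S /andP[j0 jk]; apply: cn; rewrite j0 (leq_trans jk).
  - by apply: leq_trans kM; rewrite leq_pmul2l.
  - have [|sc] := cov i M sM iM; first by left.
    by case: (tutte_connected_no_small_cocircuit _ kM cn sc); rewrite /k'; lia.
  (* The refinement of [Psi] covers only simple matroids, so the dual of [M] must be shown
     simple. *)
  - have sM' : simple (underlying (rdual M)).
      by apply: simple_rdual; apply: tutte_connected_cosimple kM cn; rewrite /k'; lia.
    have [|sc] := cov' j _ sM' jM; first by right.
    by case: (@tutte_connected_no_small_cocircuit _ (rdual M) k' N' _ kM (tutte_connected_rdual cn) sc);
      rewrite /k'; lia.
have [s' [Phi' [N [rf sub cov]]]] := family_refinement Phi.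
have [t' [Psi' [N' [rf' sub' cov']]]] := family_refinement Psi.
pose k' := (k + N + N' + 3)%N; have kk' : (k <= k')%N by rewrite /k'; lia.
(* An $M(K_{n'})$-minor forces rank at least $n'-1$, which exceeds [N] and [N']. In the cyclic case
   the dual minor bounds the rank of the dual. *)
pose n' := (n + N + N' + 3)%N; have nn' : (n <= n')%N by rewrite /n'; lia.
exists k', n', s', t', Phi', Psi'; split=> //.
- by rewrite /k' /n'; lia.
- by split=> i M; [case/sub => j; apply: c1|case/sub' => j; apply: c2].
- move=> M MM sM cn minor noPG.
  have [||i iM] := d1 M MM sM _ _ noPG.
  + by move=> S rS; apply: cn; apply: leq_trans rS _; rewrite leq_add2l.
  + exact: has_minor_MK minor.
  have [//|sc] := cov i M sM iM.
  have := has_minor_full_rank minor; have := MK_full_rank n' => r1 r2.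
  by case: (vertically_connected_no_small_cocircuit _ _ cn sc); move: r1 r2; rewrite /k' /n'; lia.
- move=> M MM sM cn minor noPG.
  have [||j jM] := d2 M MM sM _ _ noPG.
  + by move=> S rS; apply: cn; apply: leq_trans rS _; rewrite leq_add2l.
  + exact: has_minor_dual_MK minor.
  have [//|sc] := cov' j _ (simple_rdual sM) jM.
  have := has_minor_dual_full_rank minor; have := MK_full_rank n' => r1.
  rewrite -full_rank_rdual => r2.
  case: (vertically_connected_no_small_cocircuit _ _ (vertically_connected_rdual cn) sc);
    by move: r1 r2; rewrite /k' /n'; lia.
Qed.
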